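(* Let $k$ be a field of characteristic $0$, $K$ a function field over $k$, and let $(E,\nabla)$ be a vertical pseudo-admissible connection on the trivial bundle $E=V\otimes_K\mathcal{O}_{\mathbb{P}^1_K}$ ($V$ a finite dimensional $K$-vector space) on $\mathbb{P}^1_K$, with singular points $a_1,\dots,a_N\in K$ (so $\infty$ is not singular) of multiplicities $m_1,\dots,m_N$, having at least one singularity of multiplicity $\ge2$; number the points so that $m_N\ge2$. Let $\eta_\gamma,\eta_\nabla:H\to H\otimes_K\Omega^1_K$ be the associated Higgs and de Rham operators. Then $$\operatorname{Tr}(\eta_\gamma-\eta_\nabla)\equiv\frac12\sum_{i:\,m_i\ge2}m_i\,d\log(\det(g^{(i)}_{m_i}))\mod d\log K^\times .$$
   Context: $\Omega^1_K=\Omega^1_{K/k}$; $t$ is the coordinate on $\mathbb{P}^1_K$; $D=\{a_1,\dots,a_N\}$ (distinct points); $\omega$ denotes relative 1-forms of $\mathbb{P}^1_K/K$. Put $M_i=m_i-1$ if $m_i\ge2$ and $M_i=1$ if $m_i=1$. The (absolute) connection has the form $\nabla=d+\gamma+\eta$ with $$\gamma=\sum_{i=1}^N\sum_{r=1}^{m_i}\frac{g^{(i)}_r\,d(t-a_i)}{(t-a_i)^r},\qquad \eta=\eta_0+\sum_{i=1}^N\sum_{r=1}^{M_i}\frac{\eta^{(i)}_r}{(t-a_i)^r},$$ where $g^{(i)}_r\in\operatorname{End}_K(V)$ and $\eta_0,\eta^{(i)}_r\in\operatorname{End}_K(V)\otimes\Omega^1_K$; pseudo-admissibility means that it has this shape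 with every $g^{(i)}_{m_i}$ invertible, and regularity at $\infty$ means $\sum_ig^{(i)}_1=0$. Vertical means that the curvature $\nabla^2$ lies in $\operatorname{End}(V)\otimes\Omega^2_K\otimes\mathcal{O}( *D)$. The relative connection is $\nabla_{/K}=d+\gamma_K$ with $\gamma_K=\sum_i\sum_r\frac{g^{(i)}_r\,dt}{(t-a_i)^r}$. With $(e_\mu)$ a basis of $V$, $H\overset{\sigma}{\hookrightarrow}\Gamma(\mathbb{P}^1_K,E\otimes\omega( *D))$ is the $K$-subspace with basis: $\frac{e_\mu\,dt}{(t-a_i)^r}$ for $2\le r\le m_i$, $1\le i\le N-1$, and for $2\le r\le m_N-1$, $i=N$; and $e_\mu\,dt\big(\frac1{t-a_i}-\frac1{t-a_N}\big)$ for $i<N$. It is a standing assumption that $H$ maps isomorphically onto both $\Gamma(E\otimes\omega( *D))/\gamma_K\Gamma(E( *D))$ and $\Gamma(E\otimes\omega( *D))/\nabla_{/K}\Gamma(E( *D))$; the resulting projections of $\Gamma(E\otimes\omega( *D))$ onto $H$ are denoted $\pi_\gamma$ and $\pi_\nabla$. Multiplication by $\eta$ gives $\eta:\Gamma(E\otimes\omega( *D))\to\Gamma(E\otimes\omega( *D))\otimes\Omega^1_K$. The Higgs operator is $\eta_\gamma=\pi_\gamma\circ\eta\circ\sigma$, the de Rham operator is $\eta_\nabla=\pi_\nabla\circ\eta\circ\sigma$, both $K$-linear maps $H\to H\otimes\Omega^1_K$; their traces lie in $\Omega^1_K$. *)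

(* Defs.v *)
From HB Require Import structures.
From mathcomp Require Import all_boot all_order all_algebra.
Set Implicit Arguments.
Unset Strict Implicit.
Unset Printing Implicit Defensive.
Import GRing.Theory.
Local Open Scope ring_scope.

Definition function_field (k L : fieldType) (i : {rmorphism k -> L}) : Prop :=
  exists s : seq L, forall P : L -> Prop,
    (forall c, P (i c)) -> (forall x, x \in s -> P x) ->
    (forall x y, P x -> P y -> P (x - y)) ->
    (forall x y, P x -> P y -> P (x * y)) ->
    (forall x, P x -> P x^-1) ->
    forall x, P x.

Definition derivation (k L : fieldType) (i : {rmorphism k -> L})
    (M : lmodType L) (D : L -> M) : Prop :=
  [/\ forall x y, D (x + y) = D x + D y,
      forall x y, D (x * y) = x *: D y + y *: D x
    & forall c, D (i c) = 0].

Definition kaehler (k L : fieldType) (i : {rmorphism k -> L})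
    (Om : lmodType L) (d : L -> Om) : Prop :=
  derivation i d /\
  forall (M : lmodType L) (D : L -> M), derivation i D ->
    exists f : {linear Om -> M}, (forall x, f (d x) = D x) /\
      forall f' : {linear Om -> M}, (forall x, f' (d x) = D x) -> f' =1 f.

Definition alternating (L : fieldType) (M N : lmodType L) (b : M -> M -> N) :
    Prop :=
  [/\ forall c u v w, b (c *: u + v) w = c *: b u w + b v w,
      forall c u v w, b w (c *: u + v) = c *: b w u + b w v
    & forall u, b u u = 0].

Definition exterior_square (L : fieldType) (Om Om2 : lmodType L)
    (wedge : Om -> Om -> Om2) : Prop :=
  alternating wedge /\
  forall (N : lmodType L) (b : Om -> Om -> N), alternating b ->
    exists f : {linear Om2 -> N}, (forall u v, f (wedge u v) = b u v) /\
      forall f' : {linear Om2 -> N},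
        (forall u v, f' (wedge u v) = b u v) -> f' =1 f.

Definition exterior_derivative (L : fieldType) (Om Om2 : lmodType L)
    (d : L -> Om) (wedge : Om -> Om -> Om2) (d1 : Om -> Om2) : Prop :=
  (forall u v, d1 (u + v) = d1 u + d1 v) /\
  (forall x y, d1 (x *: d y) = wedge (d x) (d y)).

Definition dlog (L : fieldType) (Om : lmodType L) (d : L -> Om) (x : L) : Om :=
  x^-1 *: d x.

Notation ratF K := {fraction {poly K}}.

Definition cst (K : fieldType) : {rmorphism K -> ratF K} :=
  [the {rmorphism K -> ratF K} of (@tofrac {poly K}) \o (@polyC K)].

Definition base_to_rat (k K : fieldType) (i : {rmorphism k -> K}) :
    {rmorphism k -> ratF K} :=
  [the {rmorphism k -> ratF K} of cst K \o i].

(* The partial derivative d/dt, by the quotient rule on a representative. *)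
Definition ratderiv (K : fieldType) (f : ratF K) : ratF K :=
  let p := \n_(repr f) in let q := \d_(repr f) in
  tofrac (p^`() * q - p * q^`()) / tofrac (q ^+ 2).

(* The pull-back of 1-forms from Spec K to the projective line. *)
Definition pullback (K : fieldType) (Om : lmodType K) (d : K -> Om)
    (OmF : lmodType (ratF K)) (dF : ratF K -> OmF) (j : Om -> OmF) : Prop :=
  [/\ forall u v, j (u + v) = j u + j v,
      forall c u, j (c *: u) = cst K c *: j u
    & forall x, j (d x) = dF (cst K x)].

Section Points.
Variables (K : fieldType) (N : nat) (a : 'I_N.+1 -> K).

(* t - a_i *)
Definition tma (i : 'I_N.+1) : ratF K := tofrac ('X - (a i)%:P).

Definition denom (e : nat) : {poly K} := \prod_i ('X - (a i)%:P) ^+ e.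

(* Sections of O( *D) on the projective line: poles in D, hence in particular
   regular at infinity. *)
Definition in_O (f : ratF K) : Prop :=
  exists (e : nat) (p : {poly K}),
    f = tofrac p / tofrac (denom e) /\ (size p <= size (denom e))%N.

(* The coefficients f of the relative forms f dt with poles in D; regularity
   of f dt at infinity means that f vanishes there to order at least 2. *)
Definition in_omega (f : ratF K) : Prop :=
  exists (e : nat) (p : {poly K}),
    f = tofrac p / tofrac (denom e) /\ (size p + 2 <= size (denom e))%N.

End Points.

(* A pseudo-admissible connection d + gamma + eta on the trivial bundle with
   fibre V = K^n. The singular points are indexed by 'I_N.+1, so there are
   N + 1 >= 1 of them and the last one is ord_max. Only the values g i r with
   1 <= r <= mult i and eta i r with 1 <= r <= Mpole i are used. Elements of
   End(V) (x) Omega^1_K are matrices of forms. *)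
Record pa_connection (K : fieldType) (Om : lmodType K) (n N : nat) :=
  PaConnection {
    pt : 'I_N.+1 -> K;
    mult : 'I_N.+1 -> nat;
    g : 'I_N.+1 -> nat -> 'M[K]_n;
    eta0 : 'M[Om]_n;
    eta : 'I_N.+1 -> nat -> 'M[Om]_n;
    pt_inj : injective pt;
    mult_gt0 : forall i, (0 < mult i)%N;
    g_unit : forall i, g i (mult i) \in unitmx;
    g_res : \sum_i g i 1%N = 0
  }.

Section Connection.
Variables (K : fieldType) (Om : lmodType K) (n N : nat).
Variable C : pa_connection Om n N.

Definition Mpole (i : 'I_N.+1) : nat :=
  if (2 <= mult C i)%N then (mult C i).-1 else 1%N.

(* eta as a formal sum of products f (x) w with f in O( *D) and w in
   End(V) (x) Omega^1_K. *)
Definition eta_terms : seq (ratF K * 'M[Om]_n) :=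
  (1, eta0 C) ::
  [seq (tma (pt C) i ^- r, eta C i r)
     | i <- enum 'I_N.+1, r <- iota 1 (Mpole i)].

Section Absolute.
Variables (OmF Om2F : lmodType (ratF K)).
Variables (dF : ratF K -> OmF) (wedge : OmF -> OmF -> Om2F).
Variables (d1 : OmF -> Om2F) (j : Om -> OmF).

Definition conn_form : 'M[OmF]_n :=
  \matrix_(p, q)
    (\sum_i \sum_(1 <= r < (mult C i).+1)
       (cst K (g C i r p q) / tma (pt C) i ^+ r) *: dF (tma (pt C) i)
     + \sum_(x <- eta_terms) x.1 *: j (x.2 p q)).

(* The matrix of nabla^2, for nabla = d + conn_form on column vectors. *)
Definition curvature : 'M[Om2F]_n :=
  \matrix_(p, q) (d1 (conn_form p q)
                  + \sum_l wedge (conn_form p l) (conn_form l q)).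

(* Omega^2_K is spanned by the products u ^ v of elements of Omega^1_K. *)
Definition vertical : Prop :=
  forall p q, exists s : seq (ratF K * (Om * Om)),
    (forall x, x \in s -> in_O (pt C) x.1) /\
    curvature p q = \sum_(x <- s) x.1 *: wedge (j x.2.1) (j x.2.2).

End Absolute.

(* From here on relative forms f dt are represented by their coefficient f. *)

Definition gammaK : 'M[ratF K]_n :=
  \sum_i \sum_(1 <= r < (mult C i).+1)
    tma (pt C) i ^- r *: map_mx (cst K) (g C i r).

Definition nablaK (v : 'cV[ratF K]_n) : 'cV[ratF K]_n :=
  map_mx (@ratderiv K) v + gammaK *m v.

Definition in_E (v : 'cV[ratF K]_n) : Prop := forall p, in_O (pt C) (v p 0).
Definition in_Eomega (u : 'cV[ratF K]_n) : Prop :=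
  forall p, in_omega (pt C) (u p 0).

Definition gamma_image (u : 'cV[ratF K]_n) : Prop :=
  exists2 v, in_E v & u = gammaK *m v.
Definition nabla_image (u : 'cV[ratF K]_n) : Prop :=
  exists2 v, in_E v & u = nablaK v.

(* The scalar forms b_0, b_1, ... such that the e_mu (x) b_j are the basis
   of H. *)
Definition hbasis : seq (ratF K) :=
  [seq tma (pt C) i ^- r
     | i <- enum 'I_N.+1,
       r <- iota 2 (if i == ord_max then mult C i - 2 else mult C i - 1)%N]
  ++ [seq (tma (pt C) i)^-1 - (tma (pt C) ord_max)^-1
        | i <- enum 'I_N.+1 & i != ord_max].

(* H, in coordinates: the entry (mu, j) is the coefficient of e_mu (x) b_j. *)
Definition hspace := 'M[K]_(n, size hbasis).

Definition sigma (c : hspace) : 'cV[ratF K]_n :=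
  map_mx (cst K) c *m \col_(j < size hbasis) hbasis`_j.

(* H maps isomorphically onto the quotient of Gamma(E (x) omega( *D)) by W. *)
Definition iso_quotient (W : 'cV[ratF K]_n -> Prop) : Prop :=
  (forall c, W (sigma c) -> c = 0) /\
  (forall u, in_Eomega u -> exists c, W (u - sigma c)).

Definition is_projection (W : 'cV[ratF K]_n -> Prop)
    (proj : 'cV[ratF K]_n -> hspace) : Prop :=
  forall u, in_Eomega u -> W (u - sigma (proj u)).

(* H (x) Omega^1_K, in coordinates on the basis of H. *)
Definition hforms := 'M[Om]_(n, size hbasis).

Definition tens (c : hspace) (w : Om) : hforms :=
  \matrix_(p, q) (c p q *: w).

(* (proj (x) id) o eta o sigma: eta is the sum of the f (x) E_pq (x) w_pq,
   for (f, w) in eta_terms, with E_pq the matrix units of End(V). *)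
Definition eta_op (proj : 'cV[ratF K]_n -> hspace) (c : hspace) : hforms :=
  \sum_(x <- eta_terms) \sum_p \sum_q
    tens (proj (x.1 *: (delta_mx p q *m sigma c))) (x.2 p q).

Definition htrace (A : hspace -> hforms) : Om :=
  \sum_p \sum_q A (delta_mx p q) p q.

End Connection.

(* Main.v *)
(** Let l be a K-linear functional on the 1-forms of K and D = l o d the
corresponding derivation of K. As K is a function field the functionals l
separate 1-forms, so it suffices to prove the formula after applying l; eta
becomes a matrix over K(t) and verticality becomes the identity
dt(eta) - D gamma + [gamma, eta - sum_{i,r} g_r^(i) D(a_i) / (t - a_i)^r] = 0.

For h in H write eta h - pi_gamma (eta h) = gamma v, with v a section of
E( *D). If dv/dt = b + nabla u with b in H, then (pi_gamma - pi_nabla)(eta h)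
= b, so only the diagonal coefficients of h |-> b are needed. For
h = e_mu / (t - a_i)^r with r >= 2, v has a pole of order r - 1 at a_i with
leading coefficient g_m^-1 eta_{m-1} e_mu (m = m_i), and no other pole; this
contributes -(r - 1) (g_m^-1 eta_{m-1})_{mu mu}. For the logarithmic elements
of H at a_i, v is constant if m_i >= 2; if m_i = 1 then v has a simple pole,
which is corrected by an explicit u, and the contribution is the trace of
R Z - g_1 Z / (a_N - a_i) with Z = g_1^-1 eta_1 g_1^-1 and R the constant term
of gamma at a_i.

The verticality identity converts these traces into logarithmic derivatives:
-(m - 1) Tr(g_m^-1 eta_{m-1}) = dlog det g_m for m >= 2, and
Tr(R Z) = dlog det g_1, Tr(g_1 Z) = 0 for m = 1. Summing r - 1 over
2 <= r <= m_i (over 2 <= r <= m_N - 1 at the last point) gives the formula,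
with c the product of the det g_1^(i) over the simple points divided by
det g_{m_N}^(N). *)

Require Import Defs.
From HB Require Import structures.
From mathcomp Require Import all_boot all_order all_algebra.
From mathcomp Require Import boolp ring zify.
Import GRing.Theory.
Local Open Scope ring_scope.
Set Implicit Arguments.
Unset Strict Implicit.
Unset Printing Implicit Defensive.

(** * Derivations *)

(** Independence of the quotient rule from the representative: [e] says n/d = p/q, and [e'] is [e]
    differentiated. Multiplying [e'] by [q * d] and reducing with [e] gives the claim. *)
Lemma quotient_rule_compat (R : idomainType) (n d p q dn dd dp dq : R) :
  n * q = p * d -> n * dq + q * dn = p * dd + d * dp ->
  (dn * d - n * dd) * q ^+ 2 = (dp * q - p * dq) * d ^+ 2.
Proof.
move=> e e'; transitivity (q * d * (p * dd + d * dp - n * dq) - (n * q) * (dd * q)).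
  by rewrite -e'; ring.
transitivity (q * d * (d * dp) + q * d * p * dd - d * dq * (n * q) - (n * q) * (dd * q)).
  by ring.
by rewrite e; ring.
Qed.

(** * Extension of a derivation to the fraction field *)

Section FractionDerivation.
Variables (R : idomainType) (delta : R -> R).
Hypothesis deltaD : forall x y, delta (x + y) = delta x + delta y.
Hypothesis deltaM : forall x y, delta (x * y) = x * delta y + y * delta x.

Local Notation tf := (@tofrac R).

Lemma fraction_repr (f : {fraction R}) :
  f = tf \n_(repr f) / tf \d_(repr f).
Proof.
have d0 : tf \d_(repr f) != 0 by rewrite tofrac_eq0 denom_ratioP.
apply: (mulIf d0); rewrite divfK //.
rewrite -{1}[f]reprK; set x := repr f.
unlock FracField.tofrac; rewrite -[LHS]FracField.pi_mul.
apply/eqmodP; rewrite /= FracField.equivfE /FracField.mulf.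
by rewrite !numden_Ratio ?oner_eq0 ?mulr1 ?denom_ratioP // mulrC.
Qed.

Lemma fractionP (f : {fraction R}) :
  exists p q : R, q != 0 /\ f = tf p / tf q.
Proof.
by exists \n_(repr f), \d_(repr f); split; [apply: denom_ratioP|apply: fraction_repr].
Qed.

(** For [delta] the derivative of polynomials this unfolds to [ratderiv], so the same lemmas serve
    d/dt and the derivation acting on coefficients. *)
Definition fraction_ext (f : {fraction R}) : {fraction R} :=
  let p := \n_(repr f) in let q := \d_(repr f) in
  tf (delta p * q - p * delta q) / tf (q ^+ 2).

(** Frees the formula from the chosen representative; additivity and the Leibniz rule are then
    checked on any convenient common denominator. *)
Lemma fraction_ext_div p q : q != 0 ->
  fraction_ext (tf p / tf q) = tf (delta p * q - p * delta q) / tf (q ^+ 2).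
Proof.
move=> q0; rewrite /fraction_ext; set f := tf p / tf q.
have d0 := denom_ratioP (repr f).
move: (fraction_repr f); set n := \n_(repr f); set d := \d_(repr f) in d0 *.
have Q0 : tf q != 0 by rewrite tofrac_eq0.
have D0 : tf d != 0 by rewrite tofrac_eq0.
rewrite /f => e.
have e1 : n * q = p * d.
  apply/eqP; rewrite -tofrac_eq !tofracM.
  by rewrite (canRL (divfK Q0) e) mulrAC divfK.
have e2 : delta (n * q) = delta (p * d) by rewrite e1.
rewrite !deltaM in e2.
apply/eqP; rewrite eqr_div ?tofrac_eq0 ?expf_neq0 // -!tofracM tofrac_eq; apply/eqP.
exact: quotient_rule_compat e1 e2.
Qed.

Lemma fraction_extD f g :
  fraction_ext (f + g) = fraction_ext f + fraction_ext g.
Proof.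
have [p [q [q0 ->]]] := fractionP f; have [r [s [s0 ->]]] := fractionP g.
have Q0 : tf q != 0 by rewrite tofrac_eq0.
have S0 : tf s != 0 by rewrite tofrac_eq0.
rewrite addf_div // -!(tofracD, tofracM) !fraction_ext_div ?mulf_neq0 //.
rewrite addf_div ?tofrac_eq0 ?expf_neq0 // -!(tofracD, tofracM) -exprMn.
by congr (tf _ / tf _); rewrite !(deltaD, deltaM); ring.
Qed.

Lemma fraction_extM f g :
  fraction_ext (f * g) = f * fraction_ext g + g * fraction_ext f.
Proof.
have [p [q [q0 ->]]] := fractionP f; have [r [s [s0 ->]]] := fractionP g.
have Q0 : tf q != 0 by rewrite tofrac_eq0.
have S0 : tf s != 0 by rewrite tofrac_eq0.
rewrite mulf_div -!(tofracD, tofracM) !fraction_ext_div ?mulf_neq0 //.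
rewrite !mulf_div addf_div -?tofracM ?tofrac_eq0 ?mulf_neq0 ?expf_neq0 //.
rewrite -!(tofracD, tofracM); apply/eqP.
rewrite eqr_div ?tofrac_eq0 ?mulf_neq0 ?expf_neq0 ?mulf_neq0 //.
rewrite -!tofracM tofrac_eq; apply/eqP.
by rewrite !(deltaD, deltaM); ring.
Qed.

Lemma fraction_ext_tofrac p : fraction_ext (tf p) = tf (delta p).
Proof.
have d1 : delta 1 = 0.
  by have := deltaM 1 1; rewrite !mul1r -{1}[delta 1]addr0 => /addrI.
have {1}-> : tf p = tf p / tf 1 by rewrite tofrac1 divr1.
rewrite fraction_ext_div ?oner_eq0 // d1 expr1n tofrac1 divr1.
by rewrite mulr0 subr0 mulr1.
Qed.

End FractionDerivation.

(** * Powers, logarithmic derivatives and determinants under a derivation *)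

Section DerivationCalculus.
Variables (F : fieldType) (delta : F -> F).
Hypothesis deltaD : forall x y, delta (x + y) = delta x + delta y.
Hypothesis deltaM : forall x y, delta (x * y) = x * delta y + y * delta x.

Lemma der0 : delta 0 = 0.
Proof. by have := deltaD 0 0; rewrite addr0 -{1}[delta 0]addr0 => /addrI. Qed.

Lemma der1 : delta 1 = 0.
Proof. by have := deltaM 1 1; rewrite !mul1r -{1}[delta 1]addr0 => /addrI. Qed.

Lemma derN x : delta (- x) = - delta x.
Proof. by apply: (addrI (delta x)); rewrite -deltaD !subrr der0. Qed.

Lemma derB x y : delta (x - y) = delta x - delta y.
Proof. by rewrite deltaD derN. Qed.

Lemma der_sum (I : Type) (r : seq I) (P : pred I) (E : I -> F) :
  delta (\sum_(i <- r | P i) E i) = \sum_(i <- r | P i) delta (E i).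
Proof. by apply: big_morph; [exact: deltaD | exact: der0]. Qed.

Lemma derV x : x != 0 -> delta x^-1 = - (x ^- 2 * delta x).
Proof.
move=> x0; have := deltaM x x^-1; rewrite mulfV // der1 => /eqP.
rewrite eq_sym addr_eq0 => /eqP e; apply: (mulfI x0); rewrite e.
by field.
Qed.

Lemma derX x m : delta (x ^+ m) = m%:R * x ^+ m.-1 * delta x.
Proof.
elim: m => [|m IH]; first by rewrite expr0 der1 !mul0r.
rewrite exprS deltaM IH /=; case: m {IH} => [|m]; first by rewrite expr0 /=; ring.
by rewrite /= -[m.+2]addn1 natrD exprS; ring.
Qed.

Lemma derXV x m : x != 0 -> delta (x ^- m) = - (m%:R * x ^- m.+1 * delta x).
Proof.
move=> x0; rewrite derV ?expf_neq0 // derX.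
case: m => [|m]; first by rewrite mulr0n !mul0r mulr0.
by rewrite /= !exprS; field; rewrite ?expf_neq0 ?x0.
Qed.

Lemma der_dlogM x y : x != 0 -> y != 0 ->
  (x * y)^-1 * delta (x * y) = x^-1 * delta x + y^-1 * delta y.
Proof. by move=> x0 y0; rewrite deltaM; field; rewrite ?x0 ?y0. Qed.

Lemma der_dlogV x : x != 0 -> x^-1^-1 * delta x^-1 = - (x^-1 * delta x).
Proof. by move=> x0; rewrite derV // invrK; field. Qed.

Lemma der_dlog_prod (I : Type) (r : seq I) (P : pred I) (E : I -> F) :
  (forall i, P i -> E i != 0) ->
  (\prod_(i <- r | P i) E i)^-1 * delta (\prod_(i <- r | P i) E i)
  = \sum_(i <- r | P i) (E i)^-1 * delta (E i).
Proof.
move=> E0; elim: r => [|i r IH]; first by rewrite !big_nil der1 mulr0.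
rewrite !big_cons; case: ifP => // Pi.
rewrite der_dlogM ?E0 ?IH //; apply: (big_ind (fun x => x != 0)) => //.
  exact: oner_neq0.
by move=> x y; exact: mulf_neq0.
Qed.

Lemma der_prod n (E : 'I_n -> F) :
  delta (\prod_i E i) = \sum_i delta (E i) * \prod_(l | l != i) E l.
Proof.
elim: n E => [|n IH] E; first by rewrite !big_ord0 der1.
rewrite !big_ord_recl deltaM IH addrC; congr (_ + _).
  rewrite mulrC; congr (_ * _); rewrite [RHS]big_mkcond big_ord_recl /= mul1r.
  by apply: eq_bigr.
rewrite mulr_sumr; apply: eq_bigr => i _; rewrite mulrCA; congr (_ * _).
rewrite [RHS]big_mkcond big_ord_recl /=; congr (_ * _).
rewrite -[RHS]big_mkcond; apply: eq_bigl => l.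
by rewrite (inj_eq lift_inj).
Qed.

(** Jacobi's formula. Differentiating the expansion over permutations acts on one row at a time; the
    terms for row i form the determinant of [A] with that row differentiated, which is expanded
    along row i into cofactors of [A]. *)
Lemma der_det n (A : 'M[F]_n) : A \in unitmx ->
  (\det A)^-1 * delta (\det A) = \tr (invmx A *m map_mx delta A).
Proof.
move=> Au; rewrite /invmx Au -scalemxAl linearZ /=; congr (_ * _).
have -> : delta (\det A) = \sum_i \sum_q delta (A i q) * cofactor A i q.
  rewrite /determinant der_sum.
  under eq_bigr => s _.
    rewrite deltaM [delta (_ ^+ _)]derX derN der1 oppr0 !mulr0 addr0.
    rewrite der_prod mulr_sumr; over.
  rewrite exchange_big; apply: eq_bigr => i _ /=.
  pose B : 'M[F]_n := \matrix_(u, v) if u == i then delta (A i v) else A u v.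
  transitivity (\det B).
    apply: eq_bigr => s _; congr (_ * _).
    rewrite [RHS](bigD1 i) //= mxE eqxx; congr (_ * _).
    by apply: eq_bigr => l li; rewrite mxE (negPf li).
  rewrite (expand_det_row _ i); apply: eq_bigr => q _; rewrite mxE eqxx.
  congr (_ * _); rewrite /cofactor; congr (_ * \det _).
  by apply/matrixP => u v; rewrite !mxE eq_sym (negPf (neq_lift _ _)).
rewrite exchange_big /mxtrace; apply: eq_bigr => q _; rewrite mxE.
by apply: eq_bigr => i _; rewrite !mxE mulrC.
Qed.

End DerivationCalculus.

(** * Values and principal parts of rational functions *)

Lemma mul_lead_fraction (F : fieldType) (s n P Q x : F) :
  s != 0 -> n != 0 -> Q != 0 ->
  P / (s * n * Q) - (s * n)^-1 * x = (P - x * Q) / s / (n * Q).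
Proof. by move=> s0 n0 Q0; field; rewrite s0 n0 Q0. Qed.

Lemma mul_divM (F : fieldType) (s P Q : F) :
  s != 0 -> s * (P / (s * Q)) = P / Q.
Proof. by move=> s0; rewrite invfM mulrCA [s * _]mulrA mulfV // mul1r. Qed.

Section Values.
Variables (K : fieldType) (a : K).
Implicit Types (f h : ratF K) (x y : K).

Lemma cstE x : cst K x = tofrac x%:P.
Proof. by []. Qed.

(* f is regular at a, with value x. A relation rather than a function: a
   fraction has no canonical representative whose denominator is nonzero at a. *)
Definition has_value f x := exists p q : {poly K},
  [/\ q.[a] != 0, f = tofrac p / tofrac q & x = p.[a] / q.[a]].

Lemma horner_neq0 (q : {poly K}) : q.[a] != 0 -> tofrac q != 0.
Proof. by apply: contraNneq => /eqP; rewrite tofrac_eq0 => /eqP ->; rewrite horner0. Qed.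

Lemma has_value_tofrac p : has_value (tofrac p) p.[a].
Proof. by exists p, 1; rewrite hornerC oner_eq0 tofrac1 !divr1. Qed.

Lemma has_value_cst x : has_value (cst K x) x.
Proof. by have := has_value_tofrac x%:P; rewrite hornerC. Qed.

Lemma has_value_uniq f x y : has_value f x -> has_value f y -> x = y.
Proof.
move=> [p [q [q0 -> ->]]] [r [s [s0 e ->]]].
move/eqP: e; rewrite eqr_div ?horner_neq0 // -!tofracM tofrac_eq => /eqP e.
by apply/eqP; rewrite eqr_div // -!hornerM e.
Qed.

Lemma has_valueD f h x y :
  has_value f x -> has_value h y -> has_value (f + h) (x + y).
Proof.
move=> [p [q [q0 -> ->]]] [r [s [s0 -> ->]]]; exists (p * s + r * q), (q * s).
rewrite hornerM mulf_neq0 //; split => //.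
  by rewrite addf_div ?horner_neq0 // -!(tofracM, tofracD).
by rewrite addf_div // !hornerE.
Qed.

Lemma has_valueM f h x y :
  has_value f x -> has_value h y -> has_value (f * h) (x * y).
Proof.
move=> [p [q [q0 -> ->]]] [r [s [s0 -> ->]]]; exists (p * r), (q * s).
rewrite hornerM mulf_neq0 //; split => //.
  by rewrite mulf_div -!tofracM.
by rewrite mulf_div // !hornerE.
Qed.

Lemma has_valueN f x : has_value f x -> has_value (- f) (- x).
Proof.
move=> h; rewrite -mulN1r -[- x]mulN1r; apply: has_valueM => //.
by have := has_value_cst (-1); rewrite rmorphN rmorph1.
Qed.

Lemma has_valueB f h x y :
  has_value f x -> has_value h y -> has_value (f - h) (x - y).
Proof. by move=> hf hh; apply: has_valueD => //; apply: has_valueN. Qed.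

Lemma has_value0 : has_value 0 0.
Proof. by have := has_value_cst 0; rewrite rmorph0. Qed.

Lemma has_value1 : has_value 1 1.
Proof. by have := has_value_cst 1; rewrite rmorph1. Qed.

Lemma has_valueX f x m : has_value f x -> has_value (f ^+ m) (x ^+ m).
Proof.
move=> h; elim: m => [|m IH]; first by rewrite !expr0; apply: has_value1.
by rewrite !exprS; apply: has_valueM.
Qed.

Lemma has_value_neq0 f x : has_value f x -> x != 0 -> f != 0.
Proof.
by move=> h; apply: contraNneq => f0; rewrite f0 in h; rewrite (has_value_uniq h has_value0).
Qed.

Lemma has_valueV f x : has_value f x -> x != 0 -> has_value f^-1 x^-1.
Proof.
move=> [p [q [q0 -> ->]]]; rewrite mulf_eq0 negb_or => /andP[p0 _].
by exists q, p; rewrite !invf_div.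
Qed.

Lemma has_value_sum (I : Type) (r : seq I) (P : pred I) (f : I -> ratF K) (x : I -> K) :
  (forall i, P i -> has_value (f i) (x i)) ->
  has_value (\sum_(i <- r | P i) f i) (\sum_(i <- r | P i) x i).
Proof.
move=> h; elim: r => [|i r IH]; first by rewrite !big_nil; apply: has_value0.
by rewrite !big_cons; case: ifP => // Pi; apply: has_valueD => //; apply: h.
Qed.

Lemma has_value_prod (I : Type) (r : seq I) (P : pred I) (f : I -> ratF K) (x : I -> K) :
  (forall i, P i -> has_value (f i) (x i)) ->
  has_value (\prod_(i <- r | P i) f i) (\prod_(i <- r | P i) x i).
Proof.
move=> h; elim: r => [|i r IH]; first by rewrite !big_nil; apply: has_value1.
by rewrite !big_cons; case: ifP => // Pi; apply: has_valueM => //; apply: h.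
Qed.

Definition mx_value m n (A : 'M[ratF K]_(m, n)) (B : 'M[K]_(m, n)) :=
  forall i j, has_value (A i j) (B i j).

Lemma mx_value_cst m n (B : 'M[K]_(m, n)) : mx_value (map_mx (cst K) B) B.
Proof. by move=> i j; rewrite mxE; apply: has_value_cst. Qed.

Lemma mx_value_uniq m n (A : 'M[ratF K]_(m, n)) B C :
  mx_value A B -> mx_value A C -> B = C.
Proof. by move=> hB hC; apply/matrixP => i j; apply: has_value_uniq (hB i j) (hC i j). Qed.

Lemma mx_value0 m n : mx_value (0 : 'M[ratF K]_(m, n)) 0.
Proof. by move=> i j; rewrite !mxE; apply: has_value0. Qed.

Lemma mx_valueD m n (A A' : 'M[ratF K]_(m, n)) B B' :
  mx_value A B -> mx_value A' B' -> mx_value (A + A') (B + B').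
Proof. by move=> h h' i j; rewrite !mxE; apply: has_valueD. Qed.

Lemma mx_valueN m n (A : 'M[ratF K]_(m, n)) B :
  mx_value A B -> mx_value (- A) (- B).
Proof. by move=> h i j; rewrite !mxE; apply: has_valueN. Qed.

Lemma mx_valueB m n (A A' : 'M[ratF K]_(m, n)) B B' :
  mx_value A B -> mx_value A' B' -> mx_value (A - A') (B - B').
Proof. by move=> h h'; apply: mx_valueD => //; apply: mx_valueN. Qed.

Lemma mx_valueZ m n f x (A : 'M[ratF K]_(m, n)) B :
  has_value f x -> mx_value A B -> mx_value (f *: A) (x *: B).
Proof. by move=> h h' i j; rewrite !mxE; apply: has_valueM. Qed.

Lemma mx_valueM m n p (A : 'M[ratF K]_(m, n)) (A' : 'M_(n, p)) B B' :
  mx_value A B -> mx_value A' B' -> mx_value (A *m A') (B *m B').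
Proof.
move=> h h' i j; rewrite !mxE; apply: has_value_sum => l _.
exact: has_valueM.
Qed.

Lemma has_value_trace n (A : 'M[ratF K]_n) B :
  mx_value A B -> has_value (\tr A) (\tr B).
Proof. by move=> h; apply: has_value_sum => i _; apply: h. Qed.

Lemma has_value_det n (A : 'M[ratF K]_n) B :
  mx_value A B -> has_value (\det A) (\det B).
Proof.
move=> h; apply: has_value_sum => s _; apply: has_valueM.
  by apply: has_valueX; apply: has_valueN; apply: has_value1.
by apply: has_value_prod => i _; apply: h.
Qed.

Lemma unitmx_value n (A : 'M[ratF K]_n) B :
  mx_value A B -> B \in unitmx -> A \in unitmx.
Proof.
rewrite !unitmxE !unitfE => h; exact: has_value_neq0 (has_value_det h).
Qed.

(** The determinant and the cofactors are polynomial in the entries, so they specialise at [a], and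
    the determinant has a nonzero value there. *)
Lemma mx_value_inv n (A : 'M[ratF K]_n) B :
  mx_value A B -> B \in unitmx -> mx_value (invmx A) (invmx B).
Proof.
move=> h uB; have uA := unitmx_value h uB.
rewrite /invmx uA uB; apply: mx_valueZ.
  apply: has_valueV; first exact: has_value_det.
  by rewrite -unitfE -unitmxE.
move=> i j; rewrite !mxE; apply: has_valueM.
  by apply: has_valueX; apply: has_valueN; apply: has_value1.
by apply: has_value_det => u v; rewrite !mxE; apply: h.
Qed.

End Values.

(** * Partial fractions and orders at infinity *)

Section Polar.
Variables (K : fieldType) (N : nat) (a : 'I_N.+1 -> K).
Hypothesis a_inj : injective a.
Local Notation s := (tma a).

Lemma tma_neq0 i : s i != 0.
Proof. by rewrite tofrac_eq0 polyXsubC_eq0. Qed.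
#[local] Hint Resolve tma_neq0 : core.

Lemma has_value_tma i l : has_value (a i) (s l) (a i - a l).
Proof. by have := has_value_tofrac (a i) ('X - (a l)%:P); rewrite hornerXsubC. Qed.

Lemma has_value_tma0 i : has_value (a i) (s i) 0.
Proof. by have := has_value_tma i i; rewrite subrr. Qed.

Lemma pt_neq i l : l != i -> a i - a l != 0.
Proof. by rewrite subr_eq0 (inj_eq a_inj) eq_sym. Qed.

Lemma has_value_tmaV i l r : l != i ->
  has_value (a i) (s l ^- r) ((a i - a l) ^- r).
Proof.
move=> li; apply: has_valueV; first exact/has_valueX/has_value_tma.
by rewrite expf_neq0 ?pt_neq.
Qed.

Lemma has_value_tmaX0 i m : (0 < m)%N -> has_value (a i) (s i ^+ m) 0.
Proof.
by move=> m0; have := has_valueX m (has_value_tma0 i); rewrite expr0n eqn0Ngt m0.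
Qed.

Lemma tmaXV i m r : (r <= m)%N -> s i ^+ m * s i ^- r = s i ^+ (m - r).
Proof. by move=> rm; rewrite -{1}(subnK rm) exprD mulfK // expf_neq0. Qed.

Definition polar (rho : 'I_N.+1 -> nat) (c : 'I_N.+1 -> nat -> K) : ratF K :=
  \sum_i \sum_(1 <= r < (rho i).+1) s i ^- r * cst K (c i r).

(* The terms of polar rho c without pole at a_i. *)
Definition polar_reg rho c i : ratF K :=
  \sum_(l | l != i) \sum_(1 <= r < (rho l).+1) s l ^- r * cst K (c l r).

Definition polar_reg_value (rho : 'I_N.+1 -> nat) c i : K :=
  \sum_(l | l != i) \sum_(1 <= r < (rho l).+1) (a i - a l) ^- r * c l r.

Lemma has_value_polar_reg rho c i :
  has_value (a i) (polar_reg rho c i) (polar_reg_value rho c i).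
Proof.
apply: has_value_sum => l li; apply: has_value_sum => r _.
apply: has_valueM; last exact: has_value_cst.
exact: has_value_tmaV.
Qed.

Lemma polar_split rho c i : polar rho c =
  \sum_(1 <= r < (rho i).+1) s i ^- r * cst K (c i r) + polar_reg rho c i.
Proof. by rewrite /polar (bigD1 i). Qed.

(** After multiplication by (t - a_i)^m only the term of exact order m survives at a_i. The
    conditional covers both the leading coefficient and the vanishing when m exceeds the pole
    order. *)
Lemma has_value_polar_lead rho c i m : (rho i <= m)%N -> (0 < m)%N ->
  has_value (a i) (s i ^+ m * polar rho c) (if (m <= rho i)%N then c i m else 0).
Proof.
move=> rm m0; rewrite (polar_split _ _ i) mulrDr -[X in has_value _ _ X]addr0.
apply: has_valueD; last first.
  rewrite -(mul0r (polar_reg_value rho c i)); apply: has_valueM.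
    exact: has_value_tmaX0.
  exact: has_value_polar_reg.
have -> : (if (m <= rho i)%N then c i m else 0)
   = \sum_(1 <= r < (rho i).+1) (if r == m then c i r else 0).
  by rewrite -big_mkcond /= big_nat1_eq ltnS m0.
rewrite mulr_sumr; rewrite big_nat_cond [X in has_value _ _ X]big_nat_cond.
apply: has_value_sum => r; rewrite andbT => /andP[_ r_le].
rewrite mulrA tmaXV; last by lia.
case: eqVneq => [->|rm'].
  by rewrite subnn expr0 mul1r; apply: has_value_cst.
rewrite -(mul0r (c i r)); apply: has_valueM; last exact: has_value_cst.
by apply: has_value_tmaX0; lia.
Qed.

Lemma polarD rho c c' :
  polar rho (fun i r => c i r + c' i r) = polar rho c + polar rho c'.
Proof.
rewrite -big_split; apply: eq_bigr => i _; rewrite -big_split.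
by apply: eq_bigr => r _; rewrite rmorphD mulrDr.
Qed.

Lemma polar_delta rho x i m : (0 < m <= rho i)%N ->
  polar rho (fun l r => if (l == i) && (r == m) then x else 0) = s i ^- m * cst K x.
Proof.
move=> mi; rewrite /polar (bigD1 i) //= [X in _ + X]big1 ?addr0; last first.
  move=> l /negPf li; rewrite big1 // => r _.
  by rewrite li /= rmorph0 mulr0.
rewrite eqxx /= (eq_bigr (fun r => if r == m then s i ^- m * cst K x else 0)).
  by rewrite -big_mkcond big_nat1_eq ltnS mi.
by move=> r _; case: eqP => [->|] //; rewrite rmorph0 mulr0.
Qed.

Lemma polar0 rho c : (forall i, rho i = 0%N) -> polar rho c = 0.
Proof. by move=> h; apply: big1 => i _; rewrite h big_geq. Qed.

Lemma poly_drop_root (P : {poly K}) x n : P.[x] = 0 -> (size P <= n.+1)%N ->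
  exists2 Q, P = Q * ('X - x%:P) & (size Q <= n)%N.
Proof.
move=> /eqP /factor_theorem[Q e] sP; exists Q => //.
have [->|Q0] := eqVneq Q 0; first by rewrite size_poly0.
by move: sP; rewrite e size_Mmonic ?monicXsubC // size_XsubC addn2.
Qed.

(** Induction on the total exponent n of the denominator. At a point with e_i > 0 one subtracts x /
    (t - a_i)^(e_i), where x is the value of P / Q at a_i; the new numerator vanishes at a_i and one
    factor cancels. The pole orders of f itself are bounded by [rho], possibly below [e]. *)
Lemma partial_fractions_prod n (e rho : 'I_N.+1 -> nat) (P : {poly K}) (f : ratF K) :
  (\sum_i e i = n)%N -> (size P <= n.+1)%N ->
  f = tofrac P / \prod_i s i ^+ e i ->
  (forall i, exists x, has_value (a i) (s i ^+ rho i * f) x) ->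
  exists c0 c, f = cst K c0 + polar rho c.
Proof.
elim: n e P f => [|n IH] e P f en sP ef hf.
  exists P`_0, (fun _ _ => 0).
  have e0 i : e i = 0%N by apply/eqP; move/eqP: en; rewrite sum_nat_eq0 => /forallP/(_ i).
  rewrite ef big1 ?divr1; last by move=> i _; rewrite e0.
  rewrite {1}(size1_polyC sP) /polar big1 ?addr0 // => i _.
  by rewrite big1 // => r _; rewrite rmorph0 mulr0.
have /existsP[i ei] : [exists i, 0 < e i]%N.
  apply: contra_eqT en; rewrite negb_exists => /forallP h.
  by rewrite big1 // => i _; apply/eqP; rewrite eqn0Ngt h.
pose Q := \prod_(l | l != i) ('X - (a l)%:P) ^+ e l : {poly K}.
have Qa : Q.[a i] != 0.
  rewrite horner_prod; apply/prodf_neq0 => l li.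
  by rewrite horner_exp hornerXsubC expf_neq0 ?pt_neq.
have tQ : tofrac Q = \prod_(l | l != i) s l ^+ e l.
  by rewrite rmorph_prod; apply: eq_bigr => l _; rewrite rmorphXn.
have tQ0 : tofrac Q != 0 by apply: horner_neq0 Qa.
pose x := P.[a i] / Q.[a i].
pose e' l := (e l - (l == i))%N.
have ee' l : e l = (e' l + (l == i))%N by rewrite /e'; case: eqP => [->|_] /=; lia.
have en' : (\sum_l e' l = n)%N.
  have h : (\sum_l e l = \sum_l e' l + 1)%N.
    rewrite (eq_bigr _ (fun l _ => ee' l)) big_split /=; congr (_ + _)%N.
    by rewrite (bigD1 i) //= eqxx big1 // => l /negPf ->.
  by apply: succn_inj; rewrite -en h addn1.
have e'Q : \prod_l s l ^+ e' l = s i ^+ (e i).-1 * tofrac Q.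
  rewrite tQ (bigD1 i) //= /e' eqxx subn1; congr (_ * _).
  by apply: eq_bigr => l /negPf ->; rewrite subn0.
have eQ : \prod_l s l ^+ e l = s i ^+ e i * tofrac Q by rewrite tQ (bigD1 i).
have sQ : (size Q <= n.+1)%N.
  (* The degree of Q is bounded through divisibility: Q divides the reduced denominator, which has
     degree n. *)
  have : Q %| \prod_l ('X - (a l)%:P) ^+ e' l.
    rewrite [X in _ %| X](bigD1 i) //= dvdp_mull //.
    rewrite (eq_bigr (fun l => ('X - (a l)%:P) ^+ e l)) // => l /negPf li.
    by rewrite /e' li subn0.
  move/dvdp_leq => /(_ _)/leq_trans; apply.
    by apply/prodf_neq0 => l _; rewrite expf_neq0 ?polyXsubC_eq0.
  rewrite size_prod; last by move=> l _; rewrite expf_neq0 ?polyXsubC_eq0.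
  rewrite (eq_bigr (fun l => (e' l).+1)) => [|l _]; last exact: size_exp_XsubC.
  have -> : (\sum_l (e' l).+1 = n + N.+1)%N.
    rewrite (eq_bigr (fun l => e' l + 1)%N) => [|l _]; last by rewrite addn1.
    by rewrite big_split /= en' sum1_card card_ord.
  by rewrite cardT size_enum_ord; lia.
clearbody Q.
have [] := @poly_drop_root (P - x *: Q) (a i) n.+1.
- by rewrite !hornerE /x divfK // subrr.
- rewrite (leq_trans (size_polyD _ _)) // geq_max sP size_polyN.
  by rewrite (leq_trans (size_scale_leq _ _)) // (leq_trans sQ).
move=> P' eP' sP'.
have hxf : f - s i ^- e i * cst K x = tofrac P' / \prod_l s l ^+ e' l.
  have -> : tofrac P' = (tofrac P - cst K x * tofrac Q) / s i.
    rewrite (cstE x) -tofracM mul_polyC -tofracB eP' tofracM -/(tma a i).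
    by rewrite (mulfK (tma_neq0 i)).
  rewrite ef eQ e'Q -[in s i ^+ e i](prednK ei) exprS.
  have n0 := expf_neq0 (e i).-1 (tma_neq0 i).
  exact: (@mul_lead_fraction _ (s i) _ (tofrac P) _ (cst K x) (tma_neq0 i) n0 tQ0).
have hx : has_value (a i) (s i ^+ e i * f) x.
  rewrite ef eQ; exists P, Q; split => //.
  exact: mul_divM (expf_neq0 _ (tma_neq0 i)).
(* Either e_i <= rho_i and the subtracted term is itself polar with the allowed orders, or e_i >
   rho_i and x is the value at a_i of a positive power of t - a_i times a regular function, so x =
   0. *)
have [c' [hf' [c hc]]] : exists c', (forall l, exists y, has_value (a l)
    (s l ^+ rho l * (f - s i ^- e i * cst K x)) y) /\
    exists c, s i ^- e i * cst K x = cst K c' + polar rho c.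
  exists 0; rewrite rmorph0.
  have [er|er] := leqP (e i) (rho i); last first.
    have -> : x = 0.
      apply: (has_value_uniq hx); have [y hy] := hf i.
      rewrite -(subnK (ltnW er)) exprD -mulrA -(mul0r y).
      by apply: has_valueM => //; apply: has_value_tmaX0; rewrite subn_gt0.
    rewrite rmorph0 mulr0 subr0; split => //; exists (fun _ _ => 0).
    rewrite /polar big1 ?addr0 // => l _; rewrite big1 // => r _.
    by rewrite rmorph0 mulr0.
  split; last first.
    exists (fun l r => if (l == i) && (r == e i) then x else 0).
    by rewrite add0r polar_delta // ei.
  move=> l; have [y hy] := hf l; rewrite mulrBr mulrA.
  have [->|li] := eqVneq l i.
    have [z hz] := hf i; exists (z - 0 ^+ (rho i - e i) * x); apply: has_valueB => //.
    rewrite tmaXV //; apply: has_valueM; last exact: has_value_cst.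
    exact/has_valueX/has_value_tma0.
  eexists; apply: has_valueB hy _; apply: has_valueM; last exact: has_value_cst.
  apply: has_valueM; first exact/has_valueX/has_value_tma0.
  by apply: has_value_tmaV; rewrite eq_sym.
have [d0 [d hd]] := IH _ _ _ en' sP' hxf hf'.
exists (d0 + c'), (fun l r => d l r + c l r).
by rewrite polarD rmorphD addrACA -hd -hc subrK.
Qed.

Lemma size_denom e : size (denom a e) = (N.+1 * e).+1.
Proof.
rewrite /denom size_prod; last by move=> l _; rewrite expf_neq0 ?polyXsubC_eq0.
rewrite (eq_bigr (fun=> e.+1)) => [|l _]; last exact: size_exp_XsubC.
by rewrite sum_nat_const card_ord; lia.
Qed.

Lemma denomD e e' : denom a (e + e') = denom a e * denom a e'.
Proof. by rewrite -big_split; apply: eq_bigr => l _; rewrite exprD. Qed.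

Lemma denom_neq0 e : denom a e != 0.
Proof. by apply/prodf_neq0 => l _; rewrite expf_neq0 ?polyXsubC_eq0. Qed.

Lemma tofrac_denom e : tofrac (denom a e) = \prod_i s i ^+ e.
Proof. by rewrite rmorph_prod; apply: eq_bigr => l _; rewrite rmorphXn. Qed.

Lemma partial_fractions rho f : in_O a f ->
  (forall i, exists x, has_value (a i) (s i ^+ rho i * f) x) ->
  exists c0 c, f = cst K c0 + polar rho c.
Proof.
move=> [e [p [ef sp]]]; apply: (@partial_fractions_prod (N.+1 * e) (fun=> e) _ p).
- by rewrite sum_nat_const card_ord.
- by rewrite -size_denom.
- by rewrite -tofrac_denom.
Qed.

(* Poles in D and a zero of order at least k at infinity; k = 0 is in_O and
   k = 2 is in_omega. *)
Definition in_ord k f := exists (e : nat) (p : {poly K}),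
  f = tofrac p / tofrac (denom a e) /\ (size p + k <= size (denom a e))%N.

Lemma in_O_ord f : in_O a f <-> in_ord 0 f.
Proof. by split=> -[e [p [-> h]]]; exists e, p; rewrite ?addn0 in h *. Qed.

Lemma in_ord0 k : in_ord k 0.
Proof. by exists k, 0; rewrite tofrac0 mul0r size_poly0 size_denom; split => //; lia. Qed.

Lemma in_ordW k l f : (k <= l)%N -> in_ord l f -> in_ord k f.
Proof. by move=> kl [e [p [-> h]]]; exists e, p; split => //; lia. Qed.

Lemma in_ordM k l f h : in_ord k f -> in_ord l h -> in_ord (k + l) (f * h).
Proof.
move=> [e [p [-> sp]]] [e' [q [-> sq]]].
have [->|p0] := eqVneq p 0; first by rewrite tofrac0 !mul0r; apply: in_ord0.
have [->|q0] := eqVneq q 0; first by rewrite tofrac0 mul0r mulr0; apply: in_ord0.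
exists (e + e')%N, (p * q); rewrite mulf_div -!tofracM -denomD; split => //.
rewrite size_mul // !size_denom ?mulnDr in sp sq *.
have := size_poly_gt0 p; have := size_poly_gt0 q; rewrite p0 q0.
by move: (size p) (size q) sp sq => u v; nia.
Qed.

Lemma in_ordD k f h : in_ord k f -> in_ord k h -> in_ord k (f + h).
Proof.
move=> [e [p [-> sp]]] [e' [q [-> sq]]].
exists (e + e')%N, (p * denom a e' + q * denom a e); split.
  by rewrite addf_div ?tofrac_eq0 ?denom_neq0 // -!tofracM -tofracD -denomD.
(* A k beyond the size of the common denominator contradicts the size hypotheses; the remaining
   bound on k is what handles zero numerators below. *)
have [k0|k0] := leqP k (N.+1 * (e + e')).+1; last first.
  by rewrite !size_denom in sp sq *; exfalso; move: k0; rewrite mulnDr; lia.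
have le1 : (size (p * denom a e')%R + k <= size (denom a (e + e')))%N.
  have [->|p0] := eqVneq p 0; first by rewrite mul0r size_poly0 size_denom.
  rewrite size_mul ?denom_neq0 // !size_denom ?mulnDr in sp *.
  by have := size_poly_gt0 p; rewrite p0; move: (size p) sp => u; nia.
have le2 : (size (q * denom a e)%R + k <= size (denom a (e + e')))%N.
  have [->|q0] := eqVneq q 0; first by rewrite mul0r size_poly0 size_denom.
  rewrite size_mul ?denom_neq0 // !size_denom ?mulnDr in sq *.
  by have := size_poly_gt0 q; rewrite q0; move: (size q) sq => u; nia.
apply: leq_trans (leq_add (size_polyD _ _) (leqnn k)) _.
by rewrite addn_maxl geq_max le1 le2.
Qed.

Lemma in_ord_cst x : in_ord 0 (cst K x).
Proof.
exists 0%N, x%:P; rewrite size_denom /denom big1 ?tofrac1 ?divr1; last by move=> i; rewrite expr0.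
by split => //; have := size_polyC_leq1 x; lia.
Qed.

Lemma in_ordZ k x f : in_ord k f -> in_ord k (cst K x * f).
Proof. by move=> h; have := in_ordM (in_ord_cst x) h; rewrite add0n. Qed.

Lemma in_ordN k f : in_ord k f -> in_ord k (- f).
Proof. by move=> h; rewrite -mulN1r -(rmorph1 (cst K)) -rmorphN; apply: in_ordZ. Qed.

Lemma in_ordB k f h : in_ord k f -> in_ord k h -> in_ord k (f - h).
Proof. by move=> hf hh; apply: in_ordD => //; apply: in_ordN. Qed.

Lemma in_ord_sum k (I : Type) (r : seq I) (P : pred I) (f : I -> ratF K) :
  (forall i, P i -> in_ord k (f i)) -> in_ord k (\sum_(i <- r | P i) f i).
Proof.
move=> h; elim: r => [|i r IH]; first by rewrite big_nil; apply: in_ord0.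
by rewrite big_cons; case: ifP => // Pi; apply: in_ordD => //; apply: h.
Qed.

Lemma in_ord_tmaV i : in_ord 1 (s i)^-1.
Proof.
exists 1%N, (\prod_(l | l != i) ('X - (a l)%:P)).
have e : denom a 1 = ('X - (a i)%:P) * \prod_(l | l != i) ('X - (a l)%:P).
  by rewrite /denom (bigD1 i) //=; congr (_ * _).
have q0 : \prod_(l | l != i) ('X - (a l)%:P) != 0.
  by apply/prodf_neq0 => l _; rewrite polyXsubC_eq0.
rewrite e; split.
  by rewrite tofracM invfM mulrCA mulfV ?mulr1 // tofrac_eq0.
by rewrite size_mul ?polyXsubC_eq0 // size_XsubC addn1 add2n.
Qed.

Lemma in_ord_tmaXV i r : in_ord r (s i ^- r).
Proof.
elim: r => [|r IH]; first by rewrite expr0 invr1 -(rmorph1 (cst K)); apply: in_ord_cst.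
by rewrite exprS invfM; apply: (@in_ordM 1 r) => //; apply: in_ord_tmaV.
Qed.

(** The difference equals (a_i - a_l) / ((t - a_i)(t - a_l)). *)
Lemma in_ord_tmaVB i l : in_ord 2 ((s i)^-1 - (s l)^-1).
Proof.
have -> : (s i)^-1 - (s l)^-1 = cst K (a i - a l) * ((s i)^-1 * (s l)^-1).
  have -> : cst K (a i - a l) = s l - s i.
    rewrite /tma -tofracB cstE polyCB; congr tofrac; ring.
  by rewrite mulrBl mulrCA (mulfV (tma_neq0 l)) mulr1 (mulVKf (tma_neq0 i)).
by apply: in_ordZ; apply: (@in_ordM 1 1); apply: in_ord_tmaV.
Qed.

(** Clearing denominators gives (x (t - a_l) + y) D = (t - a_l) p with the size of p at least 2
    below that of D. A nonzero first factor would make the left side too large. *)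
Lemma in_ord2_log l x y : in_ord 2 (cst K x + (s l)^-1 * cst K y) -> x = 0 /\ y = 0.
Proof.
move=> [e [p [ef sp]]]; pose D := denom a e.
have D0 : tofrac D != 0 by rewrite tofrac_eq0 denom_neq0.
have E : (x *: ('X - (a l)%:P) + y%:P) * D = ('X - (a l)%:P) * p.
  apply/eqP; rewrite -tofrac_eq; apply/eqP.
  rewrite -mul_polyC tofracM tofracD 2!tofracM -/(tma a l) -!(cstE _).
  have -> : tofrac p = (cst K x + (s l)^-1 * cst K y) * tofrac D by rewrite ef divfK.
  rewrite mulrA; congr (_ * _).
  by rewrite mulrDr (mulVKf (tma_neq0 l)) mulrC.
have : x *: ('X - (a l)%:P) + y%:P == 0.
  apply: contraT => q0.
  have := congr1 (fun q : {poly K} => size q) E.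
  rewrite size_mul ?denom_neq0 //.
  have := size_polyMleq ('X - (a l)%:P) p; rewrite size_XsubC.
  move: q0 sp; rewrite -size_poly_gt0 -/D => q0 sp h1 h2; rewrite -h2 in h1.
  by move: (size p) (size D) (size (_ + _ : {poly K})) h1 q0 sp => u v w; lia.
move=> /eqP e0.
have x0 : x = 0.
  by move/polyP: e0 => /(_ 1%N); rewrite !coefE /= subr0 mulr1 addr0.
by split => //; move: e0; rewrite x0 scale0r add0r => /eqP; rewrite polyC_eq0 => /eqP.
Qed.

End Polar.

(** * Functionals on Kaehler differentials *)

Section Span.
Variables (K : fieldType) (V : lmodType K) (d : K -> V).

Definition in_span : {pred V} :=
  fun w => `[< exists s : seq (K * K), w = \sum_(x <- s) x.1 *: d x.2 >].

Lemma in_span_closed : submod_closed in_span.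
Proof.
split; first by apply/asboolP; exists [::]; rewrite big_nil.
move=> c u v /asboolP[s ->] /asboolP[t ->]; apply/asboolP.
exists ([seq (c * x.1, x.2) | x <- s] ++ t); rewrite big_cat big_map /=.
by rewrite scaler_sumr; congr (_ + _); apply: eq_bigr => x _; rewrite scalerA.
Qed.

HB.instance Definition _ := GRing.isSubmodClosed.Build K V in_span in_span_closed.

(** The span of the exact forms becomes a module of its own, to serve as a target in the universal
    property. *)
Record span_type := SpanType { span_val : V; _ : span_val \in in_span }.
HB.instance Definition _ := [isSub for span_val].
HB.instance Definition _ := [Choice of span_type by <:].
HB.instance Definition _ := [SubChoice_isSubLmodule of span_type by <:].

End Span.

(** The derivation d factors through the span of its image. By uniqueness in the universal property,
    the resulting map to the span followed by the inclusion is the identity of [Om]. *)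
Lemma kaehler_span (k K : fieldType) (emb : {rmorphism k -> K})
    (Om : lmodType K) (d : K -> Om) : kaehler emb d ->
  forall w, exists s : seq (K * K), w = \sum_(x <- s) x.1 *: d x.2.
Proof.
move=> [[dD dM dk] univ] w.
have dS x : d x \in in_span d.
  by apply/asboolP; exists [:: (1, x)]; rewrite big_seq1 scale1r.
pose D x := SpanType (dS x).
have derD : derivation emb D.
  split.
  - by move=> x y; apply: val_inj; rewrite /= dD.
  - by move=> x y; apply: val_inj; rewrite /= dM.
  - by move=> c; apply: val_inj; rewrite /= dk.
have [f [fD _]] := univ _ D derD.
have [h [_ huniq]] := univ _ d (And3 dD dM dk).
have e1 := huniq (\val \o f : {linear Om -> Om}) (fun x => congr1 val (fD x)) w.
have e2 := huniq (idfun : {linear Om -> Om}) (fun x => erefl) w.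
have -> : w = val (f w) by rewrite [RHS]e1 -e2.
by have /asboolP := valP (f w).
Qed.

Definition functional (K : fieldType) (V : lmodType K) (l : V -> K) :=
  forall c u v, l (c *: u + v) = c * l u + l v.

Section Functional.
Variables (K : fieldType) (V : lmodType K) (l : V -> K).
Hypothesis fl : functional l.

Lemma functionalD u v : l (u + v) = l u + l v.
Proof. by have := fl 1 u v; rewrite scale1r mul1r. Qed.

Lemma functional0 : l 0 = 0.
Proof. by have := functionalD 0 0; rewrite addr0 -{1}[l 0]addr0 => /addrI. Qed.

Lemma functionalZ c u : l (c *: u) = c * l u.
Proof. by have := fl c u 0; rewrite addr0 functional0 addr0. Qed.

Lemma functionalN u : l (- u) = - l u.
Proof. by rewrite -scaleN1r functionalZ mulN1r. Qed.

Lemma functional_sum (I : Type) (r : seq I) (P : pred I) (E : I -> V) :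
  l (\sum_(i <- r | P i) E i) = \sum_(i <- r | P i) l (E i).
Proof. by apply: big_morph; [exact: functionalD | exact: functional0]. Qed.

End Functional.

(** The generators may be dependent. A matrix [A] of maximal rank among those whose row space
    consists of relations contains all relations, so coordinates are well defined modulo [A]. *)
Lemma functionals_separate (K : fieldType) (V : lmodType K) n (v : 'I_n -> V) :
  (forall w, exists u : 'rV[K]_n, w = \sum_i u 0 i *: v i) ->
  forall w, (forall l : V -> K, functional l -> l w = 0) -> w = 0.
Proof.
move=> spans w hw; pose ev (u : 'rV[K]_n) := \sum_i u 0 i *: v i.
have evP c u u' : ev (c *: u + u') = c *: ev u + ev u'.
  rewrite /ev scaler_sumr -big_split; apply: eq_bigr => i _.
  by rewrite !mxE scalerDl scalerA.
have ev0 : ev 0 = 0 by apply: big1 => i _; rewrite mxE scale0r.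
pose inker (A : 'M[K]_n) := forall u, (u <= A)%MS -> ev u = 0.
pose Q r := `[< exists2 A, inker A & \rank A = r >].
have exQ : exists r, Q r.
  exists 0%N; apply/asboolP; exists 0; last by rewrite mxrank0.
  by move=> u; rewrite submx0 => /eqP ->.
have Qn r : Q r -> (r <= n)%N by move=> /asboolP[A _ <-]; apply: rank_leq_row.
have [r /asboolP[A kA rA] rmax] := ex_maxnP exQ Qn.
have kerA u : ev u = 0 -> (u <= A)%MS.
  move=> u0; apply/negPn/negP => nuA.
  have : Q (\rank (A + u)%MS).
    apply/asboolP; exists (A + u)%MS => // z /sub_addsmxP[[y1 y2] /= ->].
    rewrite -[y1 *m A]scale1r evP (kA (y1 *m A)) ?submxMl // scaler0 add0r.
    rewrite [y2]mx11_scalar mul_scalar_mx -[_ *: u]addr0 evP u0 ev0.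
    by rewrite scaler0 addr0.
  move/rmax; rewrite -rA leqNgt => /negP; apply; apply: rank_ltmx.
  rewrite ltmxE addsmxSl /=; apply: contra nuA; apply: submx_trans.
  exact: addsmxSr.
(* Coordinates are picked by choice and need not be linear; they become linear after multiplication
   by [cokermx A], whose entries then provide the functionals. *)
pose co w := projT1 (cid (spans w)).
have coP z : z = ev (co z) by rewrite /co; case: (cid _).
have co_lin c z z' : (co (c *: z + z') *m cokermx A =
    c *: (co z *m cokermx A) + co z' *m cokermx A).
  apply/eqP; rewrite scalemxAl -mulmxDl -subr_eq0 -mulmxBl -submxE.
  apply: kerA; rewrite addrC -scaleN1r evP evP -!coP.
  by rewrite scaleN1r addNr.
have lw i : (co w *m cokermx A) 0 i = 0.
  apply: (hw (fun z => (co z *m cokermx A) 0 i)) => c z z'.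
  by rewrite co_lin mxE mxE.
rewrite [w]coP; apply: kA; rewrite submxE; apply/eqP/rowP => i.
by rewrite lw mxE.
Qed.

(** The differentials of finitely many field generators span all forms, by induction over the field
    operations; this brings the question to [functionals_separate]. *)
Lemma kaehler_separate (k K : fieldType) (emb : {rmorphism k -> K})
    (Om : lmodType K) (d : K -> Om) : function_field emb -> kaehler emb d ->
  forall w, (forall l : Om -> K, functional l -> l w = 0) -> w = 0.
Proof.
move=> [s gen] kd; have [[dD dM dk] _] := kd.
pose v (i : 'I_(size s)) := d s`_i.
pose sp w := exists u : 'rV[K]_(size s), w = \sum_i u 0 i *: v i.
have sp0 : sp 0 by exists 0; rewrite big1 // => i _; rewrite mxE scale0r.
have spL c w z : sp w -> sp z -> sp (c *: w + z).
  move=> [u ->] [u' ->]; exists (c *: u + u').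
  rewrite scaler_sumr -big_split; apply: eq_bigr => i _ /=.
  by rewrite !mxE scalerDl scalerA.
have spZ c w : sp w -> sp (c *: w) by move=> h; rewrite -[_ *: _]addr0; apply: spL.
have spD w z : sp w -> sp z -> sp (w + z) by move=> h h'; rewrite -[w]scale1r; apply: spL.
have d0 : d 0 = 0 by have := dk 0; rewrite rmorph0.
have d1 : d 1 = 0 by have := dk 1; rewrite rmorph1.
have spd x : sp (d x).
  move: x; apply: gen => [c|x xs|x y hx hy|x y hx hy|x hx].
  - by rewrite dk.
  - have xs' : (index x s < size s)%N by rewrite index_mem.
    exists (delta_mx 0 (Ordinal xs')); rewrite (bigD1 (Ordinal xs')) //=.
    rewrite big1 => [|i /negPf ne]; last by rewrite mxE ne andbF scale0r.
    by rewrite mxE !eqxx scale1r addr0 /v /= nth_index.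
  - have -> : d (x - y) = d x + (-1) *: d y.
      by rewrite -{2}(subrK y x) [in RHS]dD scaleN1r addrK.
    by apply: spD => //; apply: spZ.
  - by rewrite dM; apply: spD; apply: spZ.
  - have [->|x0] := eqVneq x 0; first by rewrite invr0 d0.
    have e := dM x x^-1; rewrite mulfV // d1 in e.
    have -> : d x^-1 = (- (x ^- 2)) *: d x.
      apply: (scalerI x0); rewrite scalerA mulrN exprS expr1 invfM mulVKf //.
      by rewrite scaleNr; apply/eqP; rewrite -addr_eq0 -e.
    exact: spZ.
apply: (functionals_separate (v := v)) => w.
have [t ->] := kaehler_span kd w.
elim: t => [|x t IH]; first by rewrite big_nil.
by rewrite big_cons; apply: spL.
Qed.

(** * Two derivations of K(t): d/dt and the action on coefficients *)

Section RatDeriv.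
Variables (K : fieldType).

Lemma derivM_sym (p q : {poly K}) : (p * q)^`() = p * q^`() + q * p^`().
Proof. by rewrite derivM addrC [_ * q]mulrC. Qed.

Lemma ratderivD (f h : ratF K) : ratderiv (f + h) = ratderiv f + ratderiv h.
Proof. by apply: (@fraction_extD _ (@deriv K)); [exact: derivD | exact: derivM_sym]. Qed.

Lemma ratderivM (f h : ratF K) :
  ratderiv (f * h) = f * ratderiv h + h * ratderiv f.
Proof. by apply: (@fraction_extM _ (@deriv K)); exact: derivM_sym. Qed.

Lemma ratderiv_cst (x : K) : ratderiv (cst K x) = 0.
Proof.
by rewrite cstE [LHS](fraction_ext_tofrac derivM_sym) derivC tofrac0.
Qed.

Lemma ratderiv_tma N a i : ratderiv (@tma K N a i) = 1.
Proof.
by rewrite [LHS](fraction_ext_tofrac derivM_sym) derivXsubC tofrac1.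
Qed.

Lemma ratderivZ (x : K) f : ratderiv (cst K x * f) = cst K x * ratderiv f.
Proof. by rewrite ratderivM ratderiv_cst mulr0 addr0. Qed.

Lemma ratderiv_tmaXV N a i r :
  ratderiv (@tma K N a i ^- r) = - (r%:R * tma a i ^- r.+1).
Proof.
by rewrite (derXV ratderivM _ (tma_neq0 _ _)) ratderiv_tma mulr1.
Qed.

End RatDeriv.

Section CoefficientDerivation.
Variables (K : fieldType) (D : K -> K).
Hypothesis DD : forall x y, D (x + y) = D x + D y.
Hypothesis DM : forall x y, D (x * y) = x * D y + y * D x.

Definition coef_der (p : {poly K}) : {poly K} := map_poly D p.

Lemma coef_coef_der p i : (coef_der p)`_i = D p`_i.
Proof. by rewrite coef_map_id0 //; apply: (der0 DD). Qed.

Lemma coef_derD p q : coef_der (p + q) = coef_der p + coef_der q.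
Proof. by apply/polyP => i; rewrite coefD !coef_coef_der coefD DD. Qed.

Lemma coef_derM p q : coef_der (p * q) = p * coef_der q + q * coef_der p.
Proof.
apply/polyP => i; rewrite [q * _]mulrC coefD !coefM coef_coef_der coefM.
rewrite (der_sum DD) -big_split; apply: eq_bigr => m _.
by rewrite DM !coef_coef_der; congr (_ + _); rewrite mulrC.
Qed.

Definition rat_coef_der : ratF K -> ratF K := fraction_ext coef_der.

Lemma rat_coef_derD f h : rat_coef_der (f + h) = rat_coef_der f + rat_coef_der h.
Proof. by apply: fraction_extD; [exact: coef_derD | exact: coef_derM]. Qed.

Lemma rat_coef_derM f h :
  rat_coef_der (f * h) = f * rat_coef_der h + h * rat_coef_der f.
Proof. by apply: fraction_extM; exact: coef_derM. Qed.

Lemma rat_coef_der_cst x : rat_coef_der (cst K x) = cst K (D x).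
Proof.
rewrite cstE [LHS](fraction_ext_tofrac coef_derM) cstE; congr tofrac.
apply/polyP => i; rewrite coef_coef_der !coefC; case: eqP => // _.
exact: (der0 DD).
Qed.

Lemma rat_coef_der_tma N a i : rat_coef_der (@tma K N a i) = - cst K (D (a i)).
Proof.
rewrite [LHS](fraction_ext_tofrac coef_derM) cstE -tofracN; congr tofrac.
apply/polyP => m; rewrite coef_coef_der coefN !coefB coefX !coefC.
rewrite (derB DD); case: (m == 1%N); case: (m == 0%N) => /=;
  by rewrite ?(der1 DM) ?(der0 DD) ?sub0r ?oppr0.
Qed.

End CoefficientDerivation.

Lemma kaehler_functional (k K : fieldType) (emb : {rmorphism k -> K})
    (Om : lmodType K) (d : K -> Om) (D : K -> K) :
  kaehler emb d ->
  (forall x y, D (x + y) = D x + D y) ->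
  (forall x y, D (x * y) = x * D y + y * D x) ->
  (forall c, D (emb c) = 0) ->
  exists2 l : Om -> K, functional l & forall x, l (d x) = D x.
Proof.
move=> [_ univ] DD DM Dk.
have [f [fD _]] := univ (K^o : lmodType K) D (And3 DD DM Dk).
by exists f => // c u v; rewrite linearP.
Qed.

(* With l the contraction by d/dt, f is the dt-component of a 2-form, followed
   by l'. *)
Lemma exterior_square_functional (K : fieldType) (Om Om2 : lmodType K)
    (wedge : Om -> Om -> Om2) (l l' : Om -> K) :
  exterior_square wedge -> functional l -> functional l' ->
  exists2 f : Om2 -> K, functional f &
    forall u v, f (wedge u v) = l u * l' v - l v * l' u.
Proof.
move=> [_ univ] hl hl'.
have alt : alternating (fun u v => (l u * l' v - l v * l' u : K^o)).
  split=> [c u v w|c u v w|u]; last by rewrite subrr.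
  - by rewrite hl hl' -[_ *: _]/(c * _); ring.
  - by rewrite hl hl' -[_ *: _]/(c * _); ring.
have [f [fw _]] := univ _ _ alt.
by exists f => // c u v; rewrite linearP.
Qed.

Section FunctionalDerivation.
Variables (k K : fieldType) (emb : {rmorphism k -> K}).
Variables (Om : lmodType K) (d : K -> Om) (l : Om -> K).
Hypothesis kd : kaehler emb d.
Hypothesis fl : functional l.

Lemma functional_derD x y : l (d (x + y)) = l (d x) + l (d y).
Proof. by have [[dD _ _] _] := kd; rewrite dD functionalD. Qed.

Lemma functional_derM x y : l (d (x * y)) = x * l (d y) + y * l (d x).
Proof. by have [[_ dM _] _] := kd; rewrite dM functionalD // !functionalZ. Qed.

Lemma functional_der_emb c : l (d (emb c)) = 0.
Proof. by have [[_ _ dk] _] := kd; rewrite dk functional0. Qed.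

End FunctionalDerivation.

(** * Verticality *)

(** In the contraction of d(c s d(t - a)) with s = (t - a)^-r, the motion of the point a enters
    twice with opposite signs, and only the derivative of c is left. *)
Lemma contraction_cancel (F : comNzRingType) (c Dc s s' m Ds : F) :
  - (s * Dc) = c * - (m * s') * Ds - (c * - (m * s' * Ds) + s * Dc).
Proof. ring. Qed.

Lemma mul_rmorph_natN (F G : comNzRingType) (phi : {rmorphism F -> G}) c r s :
  phi c * - (r%:R * s) = s * phi (- r%:R * c).
Proof. by rewrite rmorphM rmorphN rmorph_nat; ring. Qed.

Section Scalars.
Variables (K : fieldType) (Om : lmodType K) (n N : nat).
Variables (C : pa_connection Om n N) (l : Om -> K).

Definition eta_scalar : 'M[ratF K]_n :=
  \matrix_(p, q) \sum_(x <- eta_terms C) x.1 * cst K (l (x.2 p q)).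

Lemma gammaKE p q :
  gammaK C p q = polar (pt C) (mult C) (fun i r => g C i r p q).
Proof.
rewrite /gammaK summxE; apply: eq_bigr => i _; rewrite summxE.
by apply: eq_bigr => r _; rewrite !mxE.
Qed.

Lemma eta_scalarE p q : eta_scalar p q =
  cst K (l (eta0 C p q)) + polar (pt C) (Mpole C) (fun i r => l (Defs.eta C i r p q)).
Proof.
rewrite mxE /eta_terms big_cons mul1r; congr (_ + _).
rewrite big_allpairs_dep /= /polar big_enum /=; apply: eq_bigr => i _.
by rewrite /index_iota subn1.
Qed.

Definition g_der (D : K -> K) : 'M[ratF K]_n :=
  \matrix_(p, q) polar (pt C) (mult C) (fun i r => D (g C i r p q)).

(* The part of the connection form coming from the motion of the points:
   d(t - a_i) has the component - d a_i along Spec K. *)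
Definition g_move (D : K -> K) : 'M[ratF K]_n :=
  \matrix_(p, q) polar (pt C) (mult C) (fun i r => D (pt C i) * g C i r p q).

(** Differentiation raises each pole order by one; the new entry at r = 1 carries the factor 0, so
    the lower summation bound can stay at 1. *)
Lemma ratderiv_polar (a : 'I_N.+1 -> K) rho c :
  ratderiv (polar a rho c) =
  polar a (fun i => (rho i).+1) (fun i r => - (r.-1)%:R * c i r.-1).
Proof.
rewrite (der_sum (@ratderivD K)); apply: eq_bigr => i _.
rewrite (der_sum (@ratderivD K)) [RHS]big_nat_recl //=.
rewrite mulr0n oppr0 mul0r rmorph0 mulr0 add0r.
apply: eq_bigr => r _.
rewrite mulrC ratderivZ ratderiv_tmaXV.
exact: (mul_rmorph_natN (cst K)).
Qed.

End Scalars.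

Section Vertical.
Variables (k K : fieldType) (emb : {rmorphism k -> K}).
Variables (Om : lmodType K) (d : K -> Om).
Variables (OmF Om2F : lmodType (ratF K)) (dF : ratF K -> OmF).
Variables (wedge : OmF -> OmF -> Om2F) (d1 : OmF -> Om2F) (j : Om -> OmF).
Variables (n N : nat) (C : pa_connection Om n N).
Hypothesis kd : kaehler emb d.
Hypothesis kdF : kaehler (base_to_rat emb) dF.
Hypothesis ext2 : exterior_square wedge.
Hypothesis extd : exterior_derivative dF wedge d1.
Hypothesis pb : pullback d dF j.
Hypothesis vert : vertical C dF wedge d1 j.
Variable l : Om -> K.
Hypothesis fl : functional l.

Let D x := l (d x).

(** A functional on the forms of K(t) is evaluated on a pulled-back form through a presentation by
    exact forms. It is used twice: for the contraction by d/dt, which gives 0, and for the lift of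
    [l]. *)
Lemma functional_pullback (L : OmF -> ratF K) (E : K -> K) :
  functional L -> (forall x, L (dF (cst K x)) = cst K (E x)) ->
  (forall w, exists s : seq (K * K),
    w = \sum_(x <- s) x.1 *: d x.2 /\
    L (j w) = cst K (\sum_(x <- s) x.1 * E x.2)).
Proof.
move=> fL LE w; have [s es] := kaehler_span kd w; exists s; split => //.
have [jD jZ jd] := pb.
rewrite es; elim: s {es} => [|x s IH].
  rewrite !big_nil rmorph0 (_ : j 0 = 0) ?(functional0 fL) //.
  by have := jD 0 0; rewrite addr0 -{1}[j 0]addr0 => /addrI.
by rewrite !big_cons jD (functionalD fL) IH jZ jd (functionalZ fL) LE rmorphD rmorphM.
Qed.

(** The functional [f] contracts 2-forms with d/dt and with D acting on coefficients. It kills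
    products of two pulled-back forms, hence the curvature; [d1] of the connection form yields the
    first difference and the wedge product yields the commutator. *)
Lemma vertical_identity :
  map_mx (@ratderiv K) (eta_scalar C l) - g_der C D
  + (gammaK C *m (eta_scalar C l - g_move C D)
     - (eta_scalar C l - g_move C D) *m gammaK C) = 0.
Proof.
have DD : forall x y, D (x + y) = D x + D y by exact: functional_derD kd fl.
have DM : forall x y, D (x * y) = x * D y + y * D x by exact: functional_derM kd fl.
(* [i0] is the contraction by d/dt; [L] below is the contraction by D on coefficients, under which t
   - a_i goes to - D(a_i). *)
have [i0 fi0 i0d] := kaehler_functional kdF (@ratderivD K) (@ratderivM K)
  (fun c => @ratderiv_cst K (emb c)).
have Demb c : rat_coef_der D (base_to_rat emb c) = 0.
  rewrite [LHS](rat_coef_der_cst DD DM (emb c)).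
  by rewrite /D (functional_der_emb kd fl) rmorph0.
have [L fL Ld] := kaehler_functional kdF (rat_coef_derD DD DM)
  (rat_coef_derM DD DM) Demb.
have [f ff fw] := exterior_square_functional ext2 fi0 fL.
have [d1D d1d] := extd; have [jD jZ jd] := pb.
have i0j w : i0 (j w) = 0.
  have [x|s [_ ->]] := functional_pullback (E := fun=> 0) fi0 _ w.
    by rewrite i0d ratderiv_cst rmorph0.
  by rewrite big1 ?rmorph0 // => x _; rewrite mulr0.
have Lj w : L (j w) = cst K (l w).
  have [x|s [-> ->]] := functional_pullback (E := D) fL _ w.
    by rewrite Ld (rat_coef_der_cst DD DM).
  congr (cst K _); rewrite (functional_sum fl); apply: eq_bigr => x _.
  by rewrite (functionalZ fl).
have d10 : d1 0 = 0 by have := d1D 0 0; rewrite addr0 -{1}[d1 0]addr0 => /addrI.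
have fd1 x y : f (d1 (x *: dF y)) = ratderiv x * rat_coef_der D y
    - ratderiv y * rat_coef_der D x.
  by rewrite d1d fw !i0d !Ld.
have d1sum (I : Type) (r : seq I) (E : I -> OmF) :
    f (d1 (\sum_(i <- r) E i)) = \sum_(i <- r) f (d1 (E i)).
  elim: r => [|i r IH]; first by rewrite !big_nil d10 (functional0 ff).
  by rewrite !big_cons d1D (functionalD ff) IH.
have fd1j x w : f (d1 (x *: j w)) = ratderiv x * cst K (l w).
  have [s ->] := kaehler_span kd w.
  elim: s => [|y s IH].
    rewrite !big_nil (functional0 fl) rmorph0 mulr0.
    rewrite (_ : j 0 = 0) ?scaler0 ?d10 ?(functional0 ff) //.
    by have := jD 0 0; rewrite addr0 -{1}[j 0]addr0 => /addrI.
  rewrite !big_cons jD scalerDr d1D (functionalD ff) IH (functionalD fl).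
  rewrite rmorphD mulrDr; congr (_ + _).
  rewrite jZ jd scalerA fd1 ratderiv_cst mul0r subr0 mulrC ratderivM ratderiv_cst.
  rewrite mulr0 add0r (rat_coef_der_cst DD DM) (functionalZ fl) rmorphM.
  by rewrite mulrC -mulrA mulrCA.
have conn u v : conn_form C dF j u v =
    \sum_i \sum_(1 <= r < (mult C i).+1)
       (cst K (g C i r u v) / tma (pt C) i ^+ r) *: dF (tma (pt C) i)
     + \sum_(x <- eta_terms C) x.1 *: j (x.2 u v) by rewrite mxE.
have i0c u v : i0 (conn_form C dF j u v) = gammaK C u v.
  rewrite conn (functionalD fi0) !(functional_sum fi0) [X in _ + X]big1; last first.
    by move=> y _; rewrite (functionalZ fi0) i0j mulr0.
  rewrite addr0 gammaKE; apply: eq_bigr => i _; rewrite (functional_sum fi0).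
  apply: eq_bigr => r _.
  by rewrite (functionalZ fi0) i0d ratderiv_tma mulr1 mulrC.
have Lc u v : L (conn_form C dF j u v) = (eta_scalar C l - g_move C D) u v.
  rewrite conn (functionalD fL) !(functional_sum fL) addrC !mxE; congr (_ + _).
    by apply: eq_bigr => x _; rewrite (functionalZ fL) Lj.
  rewrite -sumrN; apply: eq_bigr => i _; rewrite (functional_sum fL) -sumrN.
  apply: eq_bigr => r _.
  rewrite (functionalZ fL) Ld (rat_coef_der_tma DD DM) mulrN; congr (- _).
  by rewrite rmorphM mulrC mulrA mulrC.
apply/matrixP => p q; have : f (curvature C dF wedge d1 j p q) = 0.
  have [s [_ ->]] := vert p q; rewrite (functional_sum ff) big1 // => x _.
  by rewrite (functionalZ ff) fw !i0j !mul0r subr0 mulr0.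
rewrite mxE (functionalD ff) (functional_sum ff) => E.
rewrite mxE [RHS]mxE -[RHS]E; congr (_ + _).
  rewrite mxE [X in X + _]mxE [X in _ + X]mxE [X in - X]mxE.
  rewrite conn d1D (functionalD ff) !d1sum mxE (der_sum (@ratderivD K)).
  rewrite [RHS]addrC; congr (_ + _).
    by apply: eq_bigr => x _; rewrite fd1j mulrC ratderivZ mulrC.
  rewrite -sumrN; apply: eq_bigr => i _; rewrite d1sum -sumrN; apply: eq_bigr => r _.
  rewrite fd1 ratderiv_tma mul1r ratderivZ (rat_coef_derM DD DM).
  rewrite (derXV (rat_coef_derM DD DM) _ (tma_neq0 _ _)) ratderiv_tmaXV.
  rewrite (rat_coef_der_cst DD DM).
  exact: contraction_cancel.
rewrite !mxE -sumrB; apply: eq_bigr => m _; rewrite fw !i0c !Lc.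
by congr (_ - _); rewrite mulrC.
Qed.

End Vertical.

#[local] Arguments cst : simpl never.

(** * Local consequences of verticality *)

Section Local.
Variables (K : fieldType) (Om : lmodType K) (n N : nat).
Variables (C : pa_connection Om n N) (l : Om -> K) (D : K -> K).

Local Notation a := (pt C).
Local Notation s := (tma a).
Local Notation gam := (gammaK C).
Let a_inj := @pt_inj K Om n N C.

Definition g_lead i := g C i (mult C i).
Definition eta_lead i := map_mx l (Defs.eta C i (Mpole C i)).

Lemma mx_value_gamma i : mx_value (a i) (s i ^+ mult C i *: gam) (g_lead i).
Proof.
move=> p q; rewrite mxE gammaKE.
have := has_value_polar_lead a_inj (fun i r => g C i r p q) (leqnn (mult C i)) (mult_gt0 C i).
by rewrite leqnn.
Qed.

Lemma g_lead_unit i : g_lead i \in unitmx.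
Proof. exact: g_unit. Qed.

Lemma Mpole_gt0 i : (0 < Mpole C i)%N.
Proof. by rewrite /Mpole; case: ifP => //; case: (mult C i) => [|[]]. Qed.

Lemma mx_value_eta i : mx_value (a i) (s i ^+ Mpole C i *: eta_scalar C l) (eta_lead i).
Proof.
move=> p q; rewrite mxE eta_scalarE mulrDr -[X in has_value _ _ X]add0r.
apply: has_valueD.
  rewrite -(mul0r (l (eta0 C p q))); apply: has_valueM; last exact: has_value_cst.
  exact: has_value_tmaX0 (Mpole_gt0 i).
have := has_value_polar_lead a_inj (fun i r => l (Defs.eta C i r p q))
  (leqnn (Mpole C i)) (Mpole_gt0 i).
by rewrite leqnn mxE.
Qed.

Lemma ratderiv_eta p q : ratderiv (eta_scalar C l p q) =
  polar a (fun i => (Mpole C i).+1)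
    (fun i r => - (r.-1)%:R * l (Defs.eta C i r.-1 p q)).
Proof. by rewrite eta_scalarE ratderivD ratderiv_cst add0r ratderiv_polar. Qed.

Hypothesis vert : map_mx (@ratderiv K) (eta_scalar C l) - g_der C D
  + (gam *m (eta_scalar C l - g_move C D) - (eta_scalar C l - g_move C D) *m gam) = 0.

(* The trace against the inverse of gamma kills the commutator before any
   leading coefficient is taken. *)
Lemma trace_vertical i :
  \tr (invmx (s i ^+ mult C i *: gam) *m
       (s i ^+ mult C i *: (map_mx (@ratderiv K) (eta_scalar C l) - g_der C D))) = 0.
Proof.
have /eqP := vert; rewrite addr_eq0 => /eqP ->.
set Y := eta_scalar C l - g_move C D.
have uG := unitmx_value (mx_value_gamma i) (g_lead_unit i).
rewrite scalerN scalerBr scalemxAl scalemxAr; set G := _ *: gam in uG *.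
rewrite mulmxN mulmxBr (mulKmx uG) linearN linearB /= mulmxA [in X in _ - X]mxtrace_mulC.
by rewrite mulmxA (mulmxV uG) mul1mx subrr oppr0.
Qed.

(** With m the multiplicity, d(eta)/dt and D(gamma) both have poles of order m at a_i, with leading
    coefficients - (m - 1) eta_{m-1} and D(g_m). The claim is the value at a_i of
    [trace_vertical]. *)
Lemma irregular_trace i : (2 <= mult C i)%N ->
  \tr (invmx (g_lead i) *m map_mx D (g_lead i)) =
  - ((mult C i).-1%:R * \tr (invmx (g_lead i) *m eta_lead i)).
Proof.
move=> mi; have Mi : Mpole C i = (mult C i).-1 by rewrite /Mpole mi.
have hQ := mx_value_inv (mx_value_gamma i) (g_lead_unit i).
have hE : mx_value (a i)
    (s i ^+ mult C i *: (map_mx (@ratderiv K) (eta_scalar C l) - g_der C D))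
    (- ((mult C i).-1%:R *: eta_lead i) - map_mx D (g_lead i)).
  rewrite scalerBr; apply: mx_valueB => p q.
    rewrite mxE [X in _ * X]mxE ratderiv_eta.
    have := has_value_polar_lead (rho := fun i => (Mpole C i).+1) a_inj
      (fun i r => - (r.-1)%:R * l (Defs.eta C i r.-1 p q)) (i := i) (m := mult C i).
    rewrite Mi prednK ?(mult_gt0 C i) // !leqnn => /(_ isT isT).
    by rewrite !mxE mulNr Mi.
  rewrite mxE [X in _ * X]mxE.
  have := has_value_polar_lead a_inj (fun i r => D (g C i r p q)) (leqnn (mult C i)) (mult_gt0 C i).
  by rewrite leqnn mxE.
have := has_value_trace (mx_valueM hQ hE); rewrite trace_vertical => h0.
have := has_value_uniq h0 (has_value0 _).
rewrite mulmxBr mulmxN -scalemxAr !linearB linearN /= linearZ /= => /eqP.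
by rewrite subr_eq0 => /eqP.
Qed.

Section Simple.
Variable i : 'I_N.+1.
Hypothesis mi : mult C i = 1%N.

Let g1 := g_lead i.
Let e1 := eta_lead i.
Let Mi : Mpole C i = 1%N. Proof. by rewrite /Mpole mi. Qed.

(** This is the coefficient of (t - a_i)^-2 in the verticality identity: d(eta)/dt contributes - e1,
    D(gamma) has only a simple pole, and the motion of a_i adds a multiple of g1, which commutes
    with g1. *)
Lemma simple_commutator : g1 *m e1 - e1 *m g1 = e1.
Proof.
have hG : mx_value (a i) (s i *: gam) g1.
  by have := mx_value_gamma i; rewrite mi expr1.
have hY : mx_value (a i) (s i *: (eta_scalar C l - g_move C D)) (e1 - D (a i) *: g1).
  rewrite scalerBr; apply: mx_valueB.
    by have := mx_value_eta i; rewrite Mi expr1.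
  move=> p q; rewrite mxE [X in _ * X]mxE.
  have := has_value_polar_lead a_inj (fun i r => D (a i) * g C i r p q)
    (leqnn (mult C i)) (mult_gt0 C i).
  by rewrite leqnn mxE /g1 /g_lead mi expr1.
have hE : mx_value (a i) (s i ^+ 2 *: (map_mx (@ratderiv K) (eta_scalar C l) - g_der C D))
    (- e1 - 0).
  rewrite scalerBr; apply: mx_valueB => p q.
    rewrite mxE [X in _ * X]mxE ratderiv_eta.
    have := has_value_polar_lead (rho := fun i => (Mpole C i).+1) a_inj
      (fun i r => - (r.-1)%:R * l (Defs.eta C i r.-1 p q)) (i := i) (m := 2).
    by rewrite Mi => /(_ isT isT); rewrite !mxE Mi mulN1r.
  rewrite mxE [X in _ * X]mxE [X in has_value _ _ X]mxE.
  have := has_value_polar_lead (rho := mult C) a_inj (fun i r => D (g C i r p q))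
    (i := i) (m := 2).
  by rewrite mi => /(_ isT isT).
have h := mx_valueD hE (mx_valueB (mx_valueM hG hY) (mx_valueM hY hG)).
rewrite -!(scalemxAl, scalemxAr) !scalerA -expr2 -scalerBr -scalerDr vert scaler0 in h.
have := mx_value_uniq h (@mx_value0 _ _ _ _).
rewrite subr0 mulmxBr mulmxBl -scalemxAl -scalemxAr.
rewrite opprB [X in _ + X]addrA subrK => /eqP.
by rewrite addr_eq0 eqr_opp eq_sym => /eqP.
Qed.

Lemma simple_trace_inv : \tr (invmx g1 *m e1) = 0.
Proof.
rewrite -{1}simple_commutator mulmxBr mulKmx ?g_lead_unit // mulmxA linearB /=.
by rewrite [X in _ - X]mxtrace_mulC mulmxA mulmxV ?g_lead_unit // mul1mx subrr.
Qed.

(* Solves (g1 - 1) Z = g1^-1 e1 without inverting g1 - 1. *)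
Definition simple_solution := invmx g1 *m e1 *m invmx g1.

(** The left side is g1^-1 (g1 e1 - e1) g1^-1, and g1 e1 - e1 = e1 g1 by the commutator relation. *)
Lemma simple_solutionP : (g1 - 1%:M) *m simple_solution = invmx g1 *m e1.
Proof.
rewrite mulmxBl mul1mx /simple_solution !mulmxA mulmxV ?g_lead_unit // mul1mx.
rewrite -[X in X - _]mul1mx -(mulVmx (g_lead_unit i)) -/g1 -!mulmxA -mulmxBr.
rewrite [g1 *m (_ *m _)]mulmxA -mulmxBl -{2}simple_commutator opprB addrC subrK.
by rewrite mulmxK ?g_lead_unit.
Qed.

Lemma simple_solution_trace : \tr (g1 *m simple_solution) = 0.
Proof.
rewrite /simple_solution !mulmxA mulmxV ?g_lead_unit // mul1mx mxtrace_mulC.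
exact: simple_trace_inv.
Qed.

Definition gam_reg : 'M[ratF K]_n :=
  \matrix_(p, q) polar_reg a (mult C) (fun i r => g C i r p q) i.

Definition gam_reg_value : 'M[K]_n :=
  \matrix_(p, q) polar_reg_value a (mult C) (fun i r => g C i r p q) i.

Lemma mx_value_gam_reg : mx_value (a i) gam_reg gam_reg_value.
Proof. by move=> p q; rewrite !mxE; apply: has_value_polar_reg. Qed.

Lemma gamma_split : gam = (s i)^-1 *: map_mx (cst K) g1 + gam_reg.
Proof.
apply/matrixP => p q; rewrite gammaKE !mxE (polar_split _ _ _ i) mi big_nat1 expr1.
by rewrite /g1 /g_lead mi.
Qed.

(** The leading order of the traced identity only says Tr(g1^-1 e1) = 0, so the next order is
    needed. Expanding Q, the inverse of (t - a_i) gamma, to first order makes the double pole - e1 /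
    (t - a_i)^2 of d(eta)/dt contribute Tr(g1^-1 R g1^-1 e1), with R the value of [gam_reg]. *)
Lemma simple_trace :
  \tr (invmx g1 *m map_mx D g1) = \tr (gam_reg_value *m simple_solution).
Proof.
have hG : mx_value (a i) (s i *: gam) g1.
  by have := mx_value_gamma i; rewrite mi expr1.
have uG := unitmx_value hG (g_lead_unit i).
have hQ := mx_value_inv hG (g_lead_unit i).
have := trace_vertical i; rewrite mi expr1; set Q := invmx (s i *: gam) in hQ *.
pose e1' := map_mx (cst K) e1; pose g1' := map_mx (cst K) g1.
have g1'u : g1' \in unitmx by rewrite map_unitmx; apply: g_lead_unit.
(* This is Q (g1 + (t - a_i) [gam_reg]) = 1 multiplied on the right by g1^-1. *)
have eQ : Q = invmx g1' - s i *: (Q *m gam_reg *m invmx g1').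
  have : Q *m (s i *: gam) = 1%:M by rewrite (mulVmx uG).
  rewrite gamma_split scalerDr scalerA mulfV ?(tma_neq0 a i) // scale1r -/g1' mulmxDr.
  move=> /(congr1 (fun X => X *m invmx g1')).
  rewrite mulmxDl (mulmxK g1'u) mul1mx => e.
  apply/esym/eqP; rewrite subr_eq; apply/eqP; rewrite -[LHS]e.
  by rewrite -scalemxAr -scalemxAl.
pose rest : 'M[ratF K]_n := \matrix_(p, q) polar_reg a (fun i => (Mpole C i).+1)
    (fun i r => - (r.-1)%:R * l (Defs.eta C i r.-1 p q)) i.
pose rest_v : 'M[K]_n := \matrix_(p, q) polar_reg_value a (fun i => (Mpole C i).+1)
    (fun i r => - (r.-1)%:R * l (Defs.eta C i r.-1 p q)) i.
have hrest : mx_value (a i) rest rest_v.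
  by move=> p q; rewrite !mxE; apply: has_value_polar_reg.
have edt : map_mx (@ratderiv K) (eta_scalar C l) = rest - s i ^- 2 *: e1'.
  apply/matrixP => p q; rewrite mxE ratderiv_eta (polar_split _ _ _ i) Mi.
  have e2 : cst K (- (2.-1)%:R * l (Defs.eta C i 2.-1 p q)) = - cst K (e1 p q).
    by rewrite [2.-1]/= mulN1r rmorphN /e1 /eta_lead Mi mxE.
  have e0 : cst K (- (1.-1)%:R * l (Defs.eta C i 1.-1 p q)) = 0.
    by rewrite [1.-1]/= mulr0n oppr0 mul0r rmorph0.
  rewrite big_nat_recr // big_nat1 e0 e2 mulr0 /= add0r addrC [RHS]mxE [rest p q]mxE.
  by congr (_ + _); rewrite !mxE mulrN.
have -> : Q *m (s i *: (map_mx (@ratderiv K) (eta_scalar C l) - g_der C D)) =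
   s i *: (Q *m rest) - (s i)^-1 *: (Q *m e1') - Q *m (s i *: g_der C D).
  rewrite scalerBr mulmxBr edt scalerBr mulmxBr -scalemxAr scalerA; congr (_ - _ - _).
  by rewrite -scalemxAr expr2 invfM mulrA mulfV ?(tma_neq0 a i) // mul1r.
have tr0 : \tr (invmx g1' *m e1') = 0.
  by rewrite -map_invmx -map_mxM trace_map_mx simple_trace_inv rmorph0.
rewrite !linearB /= linearZ /= [\tr (_^-1 *: _)]linearZ /= {2}eQ mulmxBl linearB /= tr0 sub0r.
rewrite -scalemxAl linearZ /= mulrN opprK mulKf ?(tma_neq0 a i) // => h0.
have hg : mx_value (a i) (s i *: g_der C D) (map_mx D g1).
  move=> p q; rewrite mxE [X in _ * X]mxE.
  have := has_value_polar_lead a_inj (fun i r => D (g C i r p q)) (leqnn (mult C i)) (mult_gt0 C i).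
  by rewrite leqnn mxE mi expr1 /g1 /g_lead mi.
have hv1 := has_valueM (has_value_tma0 a i) (has_value_trace (mx_valueM hQ hrest)).
have hv2 := has_value_trace (mx_valueM (mx_valueM (mx_valueM hQ mx_value_gam_reg)
  (mx_value_inv (mx_value_cst (a i) g1) (g_lead_unit i))) (mx_value_cst (a i) e1)).
have hv3 := has_value_trace (mx_valueM hQ hg).
have := has_valueB (has_valueD hv1 hv2) hv3.
rewrite h0 => h; have := has_value_uniq h (has_value0 _).
rewrite mul0r add0r => /eqP; rewrite subr_eq0 => /eqP <-.
by rewrite -!mulmxA mxtrace_mulC /simple_solution !mulmxA.
Qed.

End Simple.

End Local.

(** * The space H and the two projections *)

Definition regular (K : fieldType) (a : K) (f : ratF K) := exists x, has_value a f x.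

Section Regular.
Variables (K : fieldType) (a : K).

Lemma has_value_regular f x : has_value a f x -> regular a f.
Proof. by exists x. Qed.

Lemma regularD f h : regular a f -> regular a h -> regular a (f + h).
Proof. by move=> [x hx] [y hy]; exists (x + y); apply: has_valueD. Qed.

Lemma regularM f h : regular a f -> regular a h -> regular a (f * h).
Proof. by move=> [x hx] [y hy]; exists (x * y); apply: has_valueM. Qed.

Lemma regularN f : regular a f -> regular a (- f).
Proof. by move=> [x hx]; exists (- x); apply: has_valueN. Qed.

Lemma regularX f m : regular a f -> regular a (f ^+ m).
Proof. by move=> [x hx]; exists (x ^+ m); apply: has_valueX. Qed.

Lemma regular_cst x : regular a (cst K x).
Proof. by exists x; apply: has_value_cst. Qed.

Lemma regular_sum (I : Type) (r : seq I) (P : pred I) (f : I -> ratF K) :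
  (forall i, P i -> regular a (f i)) -> regular a (\sum_(i <- r | P i) f i).
Proof.
move=> h; elim: r => [|i r IH]; first by rewrite big_nil -(rmorph0 (cst K)); apply: regular_cst.
by rewrite big_cons; case: ifP => // Pi; apply: regularD => //; apply: h.
Qed.

Lemma mx_regularP m n (A : 'M[ratF K]_(m, n)) :
  (forall i j, regular a (A i j)) -> exists B, mx_value a A B.
Proof.
move=> h.
have h1 i : exists f, forall j, has_value a (A i j) (f j) by exact: (fin_all_exists (h i)).
have [f hf] := fin_all_exists h1.
by exists (\matrix_(i, j) f i j) => i j; rewrite mxE.
Qed.

End Regular.

Section Hspace.
Variables (K : fieldType) (Om : lmodType K) (n N : nat).
Variables (C : pa_connection Om n N).
Local Notation a := (pt C).
Local Notation s := (tma a).
Let a_inj := @pt_inj K Om n N C.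

(* The elements of H are the forms with poles of order at most hbound i at
   each a_i. *)
Definition hbound (i : 'I_N.+1) : nat :=
  if i == ord_max then (mult C i).-1 else mult C i.

(* Indexes hbasis: (i, r) with r >= 2 stands for 1 / (t - a_i)^r, and (i, 1) for
   1 / (t - a_i) - 1 / (t - a_N). *)
Definition hkeys : seq ('I_N.+1 * nat) :=
  [seq (i, r) | i <- enum 'I_N.+1,
    r <- iota 2 (if i == ord_max then mult C i - 2 else mult C i - 1)%N]
  ++ [seq (i, 1%N) | i <- enum 'I_N.+1 & i != ord_max].

Definition hfun (x : 'I_N.+1 * nat) : ratF K :=
  if x.2 == 1%N then (s x.1)^-1 - (s ord_max)^-1 else s x.1 ^- x.2.

Lemma hbasisE : hbasis C = map hfun hkeys.
Proof.
rewrite /hkeys map_cat /hbasis; congr (_ ++ _); last by rewrite -map_comp.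
rewrite map_allpairs; congr flatten; apply: eq_map => i; apply/eq_in_map => r hr.
rewrite /hfun /= ifF //; apply/negP => /eqP e; move: hr.
by rewrite mem_iota e.
Qed.

Definition hkey (q : nat) := nth (ord0, 0%N) hkeys q.

Lemma size_hkeys : size (hbasis C) = size hkeys.
Proof. by rewrite hbasisE size_map. Qed.

Lemma hkey_mem (q : 'I_(size (hbasis C))) : hkey q \in hkeys.
Proof. by rewrite mem_nth // -size_hkeys. Qed.

Lemma nth_hbasis (q : 'I_(size (hbasis C))) : (hbasis C)`_q = hfun (hkey q).
Proof. by rewrite {1}hbasisE (nth_map (ord0, 0%N)) // -size_hkeys. Qed.

Lemma sum_hkey (R : nmodType) (F : 'I_N.+1 * nat -> R) :
  \sum_(q < size (hbasis C)) F (hkey q) = \sum_(x <- hkeys) F x.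
Proof. by rewrite (big_nth (ord0, 0%N)) -size_hkeys big_mkord. Qed.

Lemma sum_hkeys (R : nmodType) (F : 'I_N.+1 * nat -> R) :
  \sum_(x <- hkeys) F x =
  \sum_i \sum_(2 <= r < (hbound i).+1) F (i, r) + \sum_(i | i != ord_max) F (i, 1%N).
Proof.
rewrite /hkeys big_cat /=; congr (_ + _); last first.
  by rewrite big_map big_filter big_enum_cond.
rewrite big_allpairs_dep big_enum; apply: eq_bigr => i _; rewrite /index_iota /hbound.
by case: ifP => _; congr (\big[_/_]_(_ <- iota 2 _) _); lia.
Qed.

Hypothesis mN : (2 <= mult C ord_max)%N.

Lemma hbound_gt0 i : (0 < hbound i)%N.
Proof. by rewrite /hbound; case: eqP => [->|_]; [lia | apply: mult_gt0]. Qed.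

Lemma hbound_le i : (hbound i <= mult C i)%N.
Proof. by rewrite /hbound; case: ifP => // _; apply: leq_pred. Qed.

Lemma hkeysP x : x \in hkeys ->
  (x.2 = 1%N /\ x.1 != ord_max) \/ (2 <= x.2 <= hbound x.1)%N.
Proof.
rewrite mem_cat => /orP[|].
  move=> /allpairsPdep[i [r [_ hr ->]]]; right => /=; move: hr.
  by rewrite mem_iota /hbound; case: ifP => _; have := mult_gt0 C i; lia.
move=> /mapP[i]; rewrite mem_filter => /andP[iN _] ->; by left.
Qed.

Lemma sigmaE (c : hspace C) p :
  sigma c p 0 = \sum_q cst K (c p q) * hfun (hkey q).
Proof. by rewrite mxE; apply: eq_bigr => q _; rewrite !mxE nth_hbasis. Qed.

Lemma sigma_keys (c : 'I_n -> 'I_N.+1 -> nat -> K) (u : 'cV[ratF K]_n) :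
  (forall p, u p 0 = \sum_(x <- hkeys) cst K (c p x.1 x.2) * hfun x) ->
  u = sigma (\matrix_(p, q) c p (hkey q).1 (hkey q).2 : hspace C).
Proof.
move=> h; apply/matrixP => p z; rewrite ord1 h sigmaE -sum_hkey.
by apply: eq_bigr => q _; rewrite mxE.
Qed.

Lemma sigma_delta mu (q : 'I_(size (hbasis C))) :
  sigma (delta_mx mu q : hspace C) = hfun (hkey q) *: map_mx (cst K) (delta_mx mu 0).
Proof.
apply/matrixP => p z; rewrite ord1 sigmaE (bigD1 q) //= big1 ?addr0.
  by rewrite !mxE !eqxx !andbT mulrC.
by move=> q' /negPf ne; rewrite mxE ne andbF rmorph0 mul0r.
Qed.

Lemma sigmaP x (c b : hspace C) : sigma (x *: c + b) = cst K x *: sigma c + sigma b.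
Proof. by rewrite /sigma map_mxD map_mxZ mulmxDl scalemxAl. Qed.

Lemma sigma0 : sigma (0 : hspace C) = 0.
Proof. by rewrite /sigma map_mx0 mul0mx. Qed.

Lemma sigmaB (c b : hspace C) : sigma (c - b) = sigma c - sigma b.
Proof. by rewrite /sigma map_mxB mulmxBl. Qed.

Lemma in_ord_hfun x : x \in hkeys -> in_ord a 2 (hfun x).
Proof.
move/hkeysP => [[e _]|h]; rewrite /hfun.
  by rewrite e eqxx; apply: in_ord_tmaVB.
have /andP[h2 _] := h; rewrite (gtn_eqF h2).
exact: in_ordW h2 (in_ord_tmaXV _ _ _).
Qed.

Lemma in_ord_sigma (c : hspace C) p : in_ord a 2 (sigma c p 0).
Proof.
rewrite sigmaE; apply: in_ord_sum => q _; apply: in_ordZ.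
exact: in_ord_hfun (hkey_mem q).
Qed.

Lemma regular_tma i l : regular (a i) (s l).
Proof. exact: has_value_regular (has_value_tma _ _ _). Qed.

Lemma regular_tmaV i l r : l != i -> regular (a i) (s l ^- r).
Proof. by move=> li; apply: has_value_regular (has_value_tmaV a_inj r li). Qed.

Lemma regular_tmaXV i l m r : (r <= m)%N -> regular (a i) (s i ^+ m * s l ^- r).
Proof.
have [->|li] := eqVneq l i => rm; last first.
  by apply: regularM; [apply/regularX/regular_tma | apply: regular_tmaV].
by rewrite tmaXV //; apply/regularX/regular_tma.
Qed.

Lemma regular_tmaXW i f m r : (r <= m)%N -> regular (a i) (s i ^+ r * f) ->
  regular (a i) (s i ^+ m * f).
Proof.
move=> rm h; rewrite -(subnK rm) exprD -mulrA; apply: regularM => //.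
exact/regularX/regular_tma.
Qed.

Lemma regular_hfun i x : x \in hkeys -> regular (a i) (s i ^+ hbound i * hfun x).
Proof.
move/hkeysP => [[e xN]|h]; rewrite /hfun.
  rewrite e eqxx mulrBr; apply: regularD; last apply: regularN.
    by have := @regular_tmaXV i x.1 (hbound i) 1 (hbound_gt0 i); rewrite expr1.
  by have := @regular_tmaXV i ord_max (hbound i) 1 (hbound_gt0 i); rewrite expr1.
have /andP[h2 hb] := h; rewrite (gtn_eqF h2).
have [e|ne] := eqVneq x.1 i.
  by rewrite e; apply: regular_tmaXV; rewrite -e.
apply: regularM; [exact/regularX/regular_tma | exact: regular_tmaV].
Qed.

Lemma regular_sigma i (c : hspace C) p :
  regular (a i) (s i ^+ hbound i * sigma c p 0).
Proof.
rewrite sigmaE mulr_sumr; apply: regular_sum => q _; rewrite mulrCA.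
apply: regularM; first exact: regular_cst.
exact: regular_hfun (hkey_mem q).
Qed.

(** Each 1/(t - a_i) is replaced by its difference with 1/(t - a_N); the sum of the residues is
    collected at a_N. *)
Lemma polar_hkeys (y : 'I_N.+1 -> nat -> ratF K) :
  \sum_i \sum_(1 <= r < (hbound i).+1) s i ^- r * y i r =
  (s ord_max)^-1 * (\sum_i y i 1%N) + \sum_(x <- hkeys) y x.1 x.2 * hfun x.
Proof.
rewrite sum_hkeys /= addrCA.
rewrite (eq_bigr (fun i => (s i)^-1 * y i 1%N +
  \sum_(2 <= r < (hbound i).+1) s i ^- r * y i r)); last first.
  by move=> i _; rewrite big_ltn ?expr1 // ltnS; apply: hbound_gt0.
rewrite big_split /= addrC; congr (_ + _).
  apply: eq_bigr => i _; apply: eq_big_nat => r /andP[r2 _].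
  by rewrite /hfun /= (gtn_eqF r2) mulrC.
rewrite [LHS](bigD1 ord_max) //= [\sum_i y i 1%N](bigD1 ord_max) //= mulrDr -addrA.
congr (_ + _); rewrite mulr_sumr -big_split /=.
apply: eq_bigr => i _; rewrite /hfun /= mulrBr addrC.
by rewrite [y i 1%N * (s i)^-1]mulrC [y i 1%N * _]mulrC subrK.
Qed.

(** f minus its candidate in H is c0 plus the sum of the residues over t - a_N; the double zero at
    infinity forces both to vanish. *)
Lemma hspace_polar f c0 c : in_ord a 2 f ->
  f = cst K c0 + polar a hbound c ->
  f = \sum_(x <- hkeys) cst K (c x.1 x.2) * hfun x.
Proof.
move=> hf ef; set h := \sum_(x <- hkeys) _.
have hh : in_ord a 2 h.
  rewrite /h big_seq; apply: in_ord_sum => x xk; apply: in_ordZ.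
  exact: in_ord_hfun.
have e : f - h = cst K c0 + (s ord_max)^-1 * cst K (\sum_i c i 1%N).
  rewrite ef -addrA; congr (_ + _).
  by rewrite /polar (polar_hkeys (fun i r => cst K (c i r))) -/h addrK rmorph_sum.
have := in_ordB hf hh; rewrite e => /in_ord2_log[c00 k0].
apply/eqP; rewrite -subr_eq0 e c00 k0.
by rewrite !rmorph0 mulr0 addr0.
Qed.

Lemma polar_widen (rho rho2 : 'I_N.+1 -> nat) c : (forall i, rho i <= rho2 i)%N ->
  polar a rho c = polar a rho2 (fun i r => if (r <= rho i)%N then c i r else 0).
Proof.
move=> le; apply: eq_bigr => i _.
rewrite [RHS](big_cat_nat _ (n := (rho i).+1)) ?ltnS ?le //=.
rewrite [X in _ + X]big_nat_cond [X in _ + X]big1 ?addr0.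
  by apply: eq_big_nat => r /andP[_]; rewrite ltnS => ->.
move=> r /andP[/andP[h _] _]; rewrite ifF ?rmorph0 ?mulr0 //.
by apply/negbTE; rewrite -ltnNge.
Qed.

(** Membership in H from pole orders alone. The polar coefficients are kept in the conclusion so
    that single coordinates can be read off as leading coefficients. *)
Lemma hspace_vector (u : 'cV[ratF K]_n) :
  (forall p, in_ord a 2 (u p 0)) ->
  (forall p i, regular (a i) (s i ^+ hbound i * u p 0)) ->
  exists c, (u = sigma (\matrix_(p, q) c p (hkey q).1 (hkey q).2 : hspace C)) /\
    forall p, exists c0, u p 0 = cst K c0 + polar a hbound (c p).
Proof.
move=> ou ru.
have h p : exists c, exists c0, u p 0 = cst K c0 + polar a hbound c.
  have [|c0 [c e]] := partial_fractions a_inj _ (ru p); last by exists c, c0.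
  exact/in_O_ord/(in_ordW _ (ou p)).
have [c hc] := fin_all_exists h.
exists c; split => //; apply: sigma_keys => p.
by have [c0 e] := hc p; apply: hspace_polar e.
Qed.

End Hspace.

(** A and B are the residues of v and of its correction u at a simple point. The double poles of
    their derivatives cancel against (1/s - b) gamma y, where gamma y has residue A + B. *)
Lemma simple_pole_expansion (F : fieldType) (s A B R b : F) : s != 0 ->
  s * (- (s ^- 2 * A) - s ^- 2 * B + (s^-1 - b) * (s^-1 * (A + B) + R))
  = - b * (A + B) + (1 - s * b) * R.
Proof. by move=> s0; field. Qed.

(** With s = t - a_i and e = a_N - a_i, the factor s - e is t - a_N, which exhibits the zero of 1/(t
    - a_i) - b at a_N. *)
Lemma inv_sub_const (F : fieldType) (s b e : F) : s != 0 -> b * e = 1 ->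
  s^-1 - b = - b * ((s - e) * s^-1).
Proof.
move=> s0 be; transitivity (b * e * s^-1 - b); first by rewrite be mul1r.
by field.
Qed.

Lemma zmod_rearrange (V : zmodType) (w t b u : V) :
  w - (t - b) = - u + (b + u + (w - t)).
Proof. by rewrite opprB [b + u]addrC -[u + b + _]addrA addKr addrCA. Qed.

(** * Comparison of the two projections onto H *)

Section Projections.
Variables (K : fieldType) (Om : lmodType K) (n N : nat).
Variables (C : pa_connection Om n N) (l : Om -> K).
Hypothesis fl : functional l.
Local Notation a := (pt C).
Local Notation s := (tma a).
Local Notation gam := (gammaK C).
Let a_inj := @pt_inj K Om n N C.
Hypothesis mN : (2 <= mult C ord_max)%N.

Definition subspace (W : 'cV[ratF K]_n -> Prop) :=
  W 0 /\ forall x u v, W u -> W v -> W (cst K x *: u + v).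

Lemma in_EP v : in_E C v <-> forall p, in_ord a 0 (v p 0).
Proof. by split=> h p; apply/in_O_ord; apply: h. Qed.

Lemma in_E_subspace : subspace (in_E C).
Proof.
split; first by apply/in_EP => p; rewrite mxE; apply: in_ord0.
move=> x u v /in_EP hu /in_EP hv; apply/in_EP => p; rewrite !mxE.
by apply: in_ordD; [apply: in_ordZ; apply: hu | apply: hv].
Qed.

Lemma nablaKP x u v : nablaK C (cst K x *: u + v) = cst K x *: nablaK C u + nablaK C v.
Proof.
rewrite /nablaK mulmxDr -scalemxAr scalerDr addrACA; congr (_ + _).
by apply/matrixP => p q; rewrite !mxE ratderivD ratderivZ.
Qed.

Lemma nablaK0 : nablaK C 0 = 0.
Proof.
rewrite /nablaK mulmx0 addr0; apply/matrixP => p q.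
by rewrite !mxE (der0 (@ratderivD K)).
Qed.

Lemma gamma_subspace : subspace (gamma_image C).
Proof.
have [E0 EP] := in_E_subspace.
split; first by exists 0 => //; rewrite mulmx0.
move=> x _ _ [u hu ->] [v hv ->]; exists (cst K x *: u + v); first exact: EP.
by rewrite mulmxDr -scalemxAr.
Qed.

Lemma nabla_subspace : subspace (nabla_image C).
Proof.
have [E0 EP] := in_E_subspace.
split; first by exists 0 => //; rewrite nablaK0.
move=> x _ _ [u hu ->] [v hv ->]; exists (cst K x *: u + v); first exact: EP.
by rewrite nablaKP.
Qed.

Lemma in_EomegaP (u : 'cV[ratF K]_n) : (forall p, in_ord a 2 (u p 0)) -> in_Eomega C u.
Proof. by []. Qed.

Lemma projection_unique W proj u (c : hspace C) :
  subspace W -> iso_quotient C W -> is_projection W proj -> in_Eomega C u ->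
  W (u - sigma c) -> proj u = c.
Proof.
move=> [_ WP] [inj _] hp hu hc; have hpu := hp u hu.
apply/eqP; rewrite -subr_eq0; apply/eqP/inj; rewrite sigmaB.
have := WP (-1) _ _ hpu hc.
by rewrite rmorphN rmorph1 scaleN1r opprB addrA subrK.
Qed.

Lemma subspace_sum W (I : Type) (r : seq I) (P : pred I) (x : I -> K) u :
  subspace W -> (forall i, P i -> W (u i)) ->
  W (\sum_(i <- r | P i) cst K (x i) *: u i).
Proof.
move=> [W0 WP] h; elim: r => [|i r IH]; first by rewrite big_nil.
by rewrite big_cons; case: ifP => // Pi; apply: WP => //; apply: h.
Qed.

Lemma eta_terms_ord x : x \in eta_terms C -> in_ord a 0 x.1.
Proof.
rewrite inE => /orP[/eqP ->|/allpairsPdep[i [r [_ _ ->]]]] /=.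
  by rewrite -(rmorph1 (cst K)); apply: in_ord_cst.
by apply: in_ordW (in_ord_tmaXV _ _ _).
Qed.

Lemma in_ord_eta p q : in_ord a 0 (eta_scalar C l p q).
Proof.
rewrite mxE big_seq; apply: in_ord_sum => x xe; rewrite mulrC; apply: in_ordZ.
exact: eta_terms_ord.
Qed.

Lemma in_ord_mulmx k (A : 'M[ratF K]_n) (u : 'cV_n) :
  (forall p q, in_ord a 0 (A p q)) -> (forall p, in_ord a k (u p 0)) ->
  forall p, in_ord a k ((A *m u) p 0).
Proof.
move=> hA hu p; rewrite mxE; apply: in_ord_sum => q _.
by have := in_ordM (hA p q) (hu q).
Qed.

(** [is_projection] only asserts a congruence modulo [W]; linearity of [proj] on global forms comes
    from uniqueness. Hence [l] may be applied to eta before projecting. *)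
Lemma eta_op_scalar W proj (c : hspace C) u v :
  subspace W -> iso_quotient C W -> is_projection W proj ->
  l (eta_op proj c u v) = proj (eta_scalar C l *m sigma c) u v.
Proof.
move=> sW iW pW.
pose t (x : ratF K * 'M[Om]_n) (p q : 'I_n) : 'cV[ratF K]_n := x.1 *: (delta_mx p q *m sigma c).
pose P : hspace C := \sum_p \sum_q \sum_(x <- eta_terms C) l (x.2 p q) *: proj (t x p q).
have -> : proj (eta_scalar C l *m sigma c) = P.
  apply: (projection_unique sW iW pW).
    by apply: in_EomegaP; apply: in_ord_mulmx; [exact: in_ord_eta | exact: in_ord_sigma].
  have sigmaD (b b' : hspace C) : sigma (b + b') = sigma b + sigma b'.
    by have := sigmaP 1 b b'; rewrite rmorph1 !scale1r.
  have sigmaS (I : Type) (r : seq I) (E : I -> hspace C) :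
      sigma (\sum_(i <- r) E i) = \sum_(i <- r) sigma (E i).
    by apply: big_morph; [exact: sigmaD | exact: sigma0].
  rewrite {1}[eta_scalar C l]matrix_sum_delta mulmx_suml /P sigmaS -sumrB.
  have [W0 WP] := sW.
  have WS (I : Type) (r : seq I) (E : I -> 'cV_n) :
      (forall i, W (E i)) -> W (\sum_(i <- r) E i).
    move=> h; elim: r => [|i r IH]; first by rewrite big_nil.
    by rewrite big_cons -[E i]scale1r -(rmorph1 (cst K)); apply: WP.
  apply: (WS) => p; rewrite mulmx_suml sigmaS -sumrB; apply: (WS) => q.
  rewrite sigmaS -scalemxAl mxE scaler_suml -sumrB.
  rewrite big_seq (eq_bigr (fun x : ratF K * 'M[Om]_n =>
    cst K (l (x.2 p q)) *: (t x p q - sigma (proj (t x p q))))).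
    apply: subspace_sum => // x xe; apply: pW; apply: in_EomegaP => r.
    rewrite mxE -[2%N]add0n; apply: in_ordM; first exact: eta_terms_ord.
    apply: in_ord_mulmx => [p' q'|p']; last exact: in_ord_sigma.
    by rewrite mxE -(rmorph_nat (cst K)); apply: in_ord_cst.
  move=> x _; rewrite scalerBr /t scalerA [cst K _ * _]mulrC; congr (_ - _).
  by have := sigmaP (l (x.2 p q)) (proj (t x p q)) 0; rewrite sigma0 !addr0.
rewrite /eta_op /P !summxE (functional_sum fl) [LHS](eq_bigr (fun x : ratF K * 'M[Om]_n =>
  \sum_p \sum_q l (x.2 p q) * proj (t x p q) u v)); last first.
  move=> x _; rewrite summxE (functional_sum fl); apply: eq_bigr => p _.
  rewrite summxE (functional_sum fl); apply: eq_bigr => q _.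
  by rewrite mxE (functionalZ fl) mulrC.
rewrite exchange_big; apply: eq_bigr => p _; rewrite exchange_big summxE.
apply: eq_bigr => q _; rewrite summxE; apply: eq_bigr => x _.
by rewrite [RHS]mxE.
Qed.

(** Since gamma v = nabla v - dv/dt and dv/dt = b + nabla u, the form w equals [proj_g w] - b plus
    nabla(v - u). *)
Lemma projection_difference proj_g proj_n (w u v : 'cV[ratF K]_n) (b : hspace C) :
  iso_quotient C (nabla_image C) -> is_projection (nabla_image C) proj_n ->
  in_Eomega C w -> in_E C v -> w - sigma (proj_g w) = gam *m v ->
  in_E C u -> map_mx (@ratderiv K) v = sigma b + nablaK C u ->
  proj_g w - proj_n w = b.
Proof.
move=> iN pN hw hv ev hu eu.
have -> : proj_n w = proj_g w - b; last by rewrite opprB addrC subrK.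
apply: (projection_unique nabla_subspace iN pN hw).
exists (v - u).
  have [_ EP] := in_E_subspace; have := EP (-1) _ _ hu hv.
  by rewrite rmorphN rmorph1 scaleN1r addrC.
have := nablaKP (-1) u v; rewrite rmorphN rmorph1 !scaleN1r => e.
rewrite [v - u]addrC e [nablaK C v]/nablaK -ev eu sigmaB.
exact: zmod_rearrange.
Qed.

(** * Diagonal coefficients of the difference of the two operators *)

Section Diagonal.
Variables (mu : 'I_n) (q : 'I_(size (hbasis C))) (c : hspace C) (v : 'cV[ratF K]_n).
Let x := hkey C q.
Let i := x.1.
Let r := x.2.
Let w := eta_scalar C l *m sigma (delta_mx mu q : hspace C).
Hypothesis hv : in_E C v.
Hypothesis ev : w - sigma c = gam *m v.
Let xk : x \in hkeys C := hkey_mem q.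

Lemma w_entry p : w p 0 = hfun C x * eta_scalar C l p mu.
Proof.
rewrite /w sigma_delta -scalemxAr map_delta_mx -colE mxE; congr (_ * _).
by rewrite mxE.
Qed.

(** Multiplication by the inverse of (t - a_j)^m gamma, with m the multiplicity at a_j, recovers v;
    this inverse has value g_m^-1 at a_j. *)
Lemma quotient_value j t B :
  mx_value (a j) (s j ^+ (mult C j + t) *: (w - sigma c)) B ->
  mx_value (a j) (s j ^+ t *: v) (invmx (g_lead C j) *m B).
Proof.
move=> h; have hG := mx_value_gamma C j.
have uG := unitmx_value hG (g_lead_unit C j).
have := mx_valueM (mx_value_inv hG (g_lead_unit C j)) h.
by rewrite ev exprD -scalerA scalemxAr scalemxAl (mulKmx uG).
Qed.

Definition hfun_pole j : nat :=
  if j == i then r else if (r == 1%N) && (j == ord_max) then 1 else 0.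

Lemma regular_hfun_pole j : regular (a j) (s j ^+ hfun_pole j * hfun C x).
Proof.
rewrite /hfun_pole /hfun -/r -/i; have [ej|nj] := eqVneq j i.
  have [e|ne] := eqVneq r 1%N; last by rewrite ej; apply: regular_tmaXV.
  rewrite e mulrBr; apply: regularD; last apply: regularN.
    by have := @regular_tmaXV _ _ _ _ C j i 1 1 (leqnn _); rewrite expr1.
  by have := @regular_tmaXV _ _ _ _ C j ord_max 1 1 (leqnn _); rewrite expr1.
have [e|ne] := eqVneq r 1%N => /=; last first.
  by rewrite expr0 mul1r; apply: regular_tmaV; rewrite eq_sym.
rewrite mulrBr; apply: regularD; last apply: regularN.
  apply: regularM; first exact/regularX/regular_tma.
  by have := @regular_tmaV _ _ _ _ C j i 1; rewrite expr1; apply; rewrite eq_sym.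
have [ej|nN] := eqVneq j ord_max.
  by have := @regular_tmaXV _ _ _ _ C j ord_max 1 1 (leqnn _); rewrite expr1.
rewrite expr0 mul1r.
by have := @regular_tmaV _ _ _ _ C j ord_max 1; rewrite expr1; apply; rewrite eq_sym.
Qed.

(** Dividing by gamma lowers the pole order by the multiplicity. The term [sigma c] causes no pole
    of v, because elements of H have poles of order at most the multiplicity. *)
Lemma regular_quotient j t p : (Mpole C j + hfun_pole j <= mult C j + t)%N ->
  regular (a j) (s j ^+ t * v p 0).
Proof.
move=> le; have [|B hB] := @mx_regularP _ (a j) _ _
    (s j ^+ (mult C j + t) *: (w - sigma c)).
  move=> p' z; rewrite ord1 mxE mxE [X in _ + X]mxE mulrDr mulrN.
  apply: regularD; last first.
    apply: regularN; apply: regular_tmaXW (regular_sigma mN j c p').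
    exact: leq_trans (hbound_le C j) (leq_addr _ _).
  apply: regular_tmaXW le _; rewrite w_entry exprD mulrACA mulrC.
  rewrite mulrA [X in X * _]mulrC -mulrA mulrC.
  rewrite (_ : _ * _ = (s j ^+ Mpole C j * eta_scalar C l p' mu) *
    (s j ^+ hfun_pole j * hfun C x)); last by rewrite mulrC; ring.
  apply: regularM; last exact: regular_hfun_pole.
  by have := mx_value_eta C l j p' mu; rewrite mxE => /has_value_regular.
have := quotient_value hB p 0; rewrite mxE; exact: has_value_regular.
Qed.

(** The strict inequality says that [sigma c] has a smaller pole than eta h, so the leading
    coefficient is that of eta h alone. *)
Lemma quotient_lead t : has_value (a i) (s i ^+ r * hfun C x) 1 ->
  (hbound C i < Mpole C i + r)%N -> (mult C i + t = Mpole C i + r)%N ->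
  mx_value (a i) (s i ^+ t *: v) (col mu (invmx (g_lead C i) *m eta_lead C l i)).
Proof.
move=> h1 lt e.
rewrite colE -mulmxA -colE; apply: quotient_value; rewrite e.
move=> p z; rewrite ord1 [col _ _ _ _]mxE mxE [X in _ * X]mxE.
rewrite [X in _ + X]mxE mulrDr mulrN.
rewrite -[eta_lead C l i p mu]subr0; apply: has_valueB.
  rewrite w_entry exprD -[X in has_value _ _ X]mulr1.
  have := has_valueM (mx_value_eta C l i p mu) h1; rewrite mxE.
  by rewrite [hfun C x * _]mulrC mulrACA.
have [y hy] := regular_sigma mN i c p.
rewrite -(subnK (ltnW lt)) exprD -mulrA -(mul0r y); apply: has_valueM => //.
by apply: has_value_tmaX0; rewrite subn_gt0.
Qed.

Lemma quotient_polar (t : 'I_N.+1 -> nat) :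
  (forall j, Mpole C j + hfun_pole j <= mult C j + t j)%N ->
  exists d, forall p, exists d0, v p 0 = cst K d0 + polar a t (d p).
Proof.
move=> le.
have h p : exists d, exists d0, v p 0 = cst K d0 + polar a t d.
  have [|d0 [d e]] := @partial_fractions _ _ _ a_inj t (v p 0) (hv p).
    by move=> j; apply: regular_quotient.
  by exists d, d0.
by have [d hd] := fin_all_exists h; exists d.
Qed.

Lemma Mpole_le j : (Mpole C j <= mult C j)%N.
Proof. by rewrite /Mpole; case: ifP => _; rewrite ?leq_pred ?mult_gt0. Qed.

Lemma in_ord_ratderiv_polar rho d : in_ord a 2
  (polar a (fun j => (rho j).+1) (fun j r => - (r.-1)%:R * d j r.-1)).
Proof.
apply: in_ord_sum => j _; rewrite big_seq; apply: in_ord_sum => m.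
rewrite mem_index_iota => /andP[m1 _]; rewrite mulrC.
have [->|m2] := eqVneq m 1%N.
  by rewrite [1.-1]/= mulr0n oppr0 mul0r rmorph0 mul0r; apply: in_ord0.
apply: in_ordZ; apply: in_ordW (in_ord_tmaXV _ _ _).
by rewrite ltn_neqAle eq_sym m2.
Qed.

Lemma has_value_lead_polar j (rho : 'I_N.+1 -> nat) d0 d : (0 < rho j)%N ->
  has_value (a j) (s j ^+ rho j * (cst K d0 + polar a rho d)) (d j (rho j)).
Proof.
move=> h; rewrite mulrDr -[d j (rho j)]add0r; apply: has_valueD.
  rewrite -(mul0r d0); apply: has_valueM; last exact: has_value_cst.
  exact: has_value_tmaX0.
by have := has_value_polar_lead a_inj d (leqnn (rho j)) h; rewrite leqnn.
Qed.

(** dv/dt has a single pole, of order at most r at a_i, and no residue, so it already lies in H and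
    u = 0 will do. *)
Lemma diagonal_irregular : (2 <= r)%N ->
  exists2 b : hspace C, map_mx (@ratderiv K) v = sigma b &
    b mu q = - (r.-1)%:R * (invmx (g_lead C i) *m eta_lead C l i) mu mu.
Proof.
move=> r2; have rh : (r <= hbound C i)%N.
  have [[e _]|/andP[_ //]] := hkeysP mN xk.
  by move: r2; rewrite /r e.
have mi : (2 <= mult C i)%N by apply: leq_trans r2 (leq_trans rh (hbound_le _ _)).
have Mi : Mpole C i = (mult C i).-1 by rewrite /Mpole mi.
pose t (j : 'I_N.+1) := if j == i then r.-1 else 0%N.
have [|d hd] := @quotient_polar t.
  move=> j; rewrite /t /hfun_pole (gtn_eqF r2) /=; case: eqP => [->|_].
    by rewrite Mi; lia.
  by rewrite !addn0 Mpole_le.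
have ti : t i = r.-1 by rewrite /t eqxx.
have t0 : (0 < t i)%N by rewrite ti; lia.
have lead p : d p i r.-1 = (invmx (g_lead C i) *m eta_lead C l i) p mu.
  have h1 : has_value (a i) (s i ^+ r * hfun C x) 1.
    rewrite /hfun -/r (gtn_eqF r2) (mulfV (expf_neq0 r (tma_neq0 a i))).
    exact: has_value1.
  have h2 : (hbound C i < Mpole C i + r)%N by have := hbound_le C i; rewrite Mi; lia.
  have h3 : (mult C i + r.-1 = Mpole C i + r)%N by rewrite Mi; lia.
  have := quotient_lead h1 h2 h3 p 0; rewrite mxE [X in has_value _ _ X]mxE.
  have [d0 ->] := hd p; rewrite -ti => hX.
  by apply: (has_value_uniq _ hX); apply: has_value_lead_polar.
(* The coefficients of dv/dt, padded with zeros up to the pole bounds of H. *)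
pose d' p j m := if (m <= (t j).+1)%N then - (m.-1)%:R * d p j m.-1 else 0.
exists (\matrix_(p, q') d' p (hkey C q').1 (hkey C q').2).
  apply: sigma_keys => p.
  have [d0 e] := hd p.
  rewrite mxE e ratderivD ratderiv_cst add0r ratderiv_polar.
  apply: (hspace_polar mN (c0 := 0)); first exact: in_ord_ratderiv_polar.
  rewrite rmorph0 add0r; apply: polar_widen => j; rewrite /t.
  case: eqP => [->|_]; last exact: hbound_gt0.
  by rewrite prednK // ltnW.
by rewrite mxE /d' -/x -/i -/r ti prednK ?leqnn ?lead // ltnW.
Qed.

(** At a_i and a_N the pole of eta is one less than that of gamma, which absorbs the simple pole of
    h. So v has no poles at all and is constant. *)
Lemma diagonal_log : r = 1%N -> (2 <= mult C i)%N -> map_mx (@ratderiv K) v = 0.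
Proof.
move=> r1 mi; have [|d hd] := @quotient_polar (fun=> 0%N).
  move=> j; rewrite /hfun_pole r1 /= addn0.
  case: eqP => [->|_]; first by rewrite /Mpole mi; lia.
  case: eqP => [->|_]; first by rewrite /Mpole mN; lia.
  by rewrite addn0 Mpole_le.
apply/matrixP => p z; rewrite ord1 !mxE; have [d0 ->] := hd p.
by rewrite polar0 // addr0 ratderiv_cst.
Qed.

Section SimplePoint.
Variable D : K -> K.
Hypothesis vert : map_mx (@ratderiv K) (eta_scalar C l) - g_der C D
  + (gam *m (eta_scalar C l - g_move C D) - (eta_scalar C l - g_move C D) *m gam) = 0.

(** As the residues of gamma sum to zero, each 1/(t - a_j) may be replaced by its difference with
    1/(t - a_N). *)
Lemma in_ord_gamma p p' : in_ord a 2 (gam p p').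
Proof.
rewrite gammaKE.
have e : polar a (mult C) (fun j m => g C j m p p') =
   \sum_j (\sum_(2 <= m < (mult C j).+1) s j ^- m * cst K (g C j m p p')
     + cst K (g C j 1%N p p') * ((s j)^-1 - (s ord_max)^-1)).
  transitivity (polar a (mult C) (fun j m => g C j m p p')
    - (\sum_j cst K (g C j 1%N p p')) * (s ord_max)^-1).
    rewrite -rmorph_sum; have /matrixP/(_ p p') := g_res C.
    by rewrite summxE mxE => ->; rewrite rmorph0 mul0r subr0.
  rewrite mulr_suml -sumrB; apply: eq_bigr => j _.
  rewrite big_ltn ?expr1; last by rewrite ltnS mult_gt0.
  by rewrite mulrBr addrA; congr (_ - _); rewrite addrC mulrC.
rewrite e; apply: in_ord_sum => j _; apply: in_ordD.
  rewrite big_seq; apply: in_ord_sum => m; rewrite mem_index_iota => /andP[m2 _].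
  rewrite mulrC; apply: in_ordZ; exact: in_ordW m2 (in_ord_tmaXV _ _ _).
by apply: in_ordZ; apply: in_ord_tmaVB.
Qed.

(** dv/dt has a double pole at a_i, which H does not allow. Adding nabla u with u = (1/(t - a_i) -
    beta) y and (g1 - 1) y equal to the residue of v removes it, and the remaining residue at a_i is
    the coefficient sought. *)
Lemma diagonal_simple : r = 1%N -> mult C i = 1%N ->
  exists (b : hspace C) (u : 'cV[ratF K]_n), [/\ in_E C u,
    map_mx (@ratderiv K) v = sigma b + nablaK C u &
    b mu q = ((gam_reg_value C i - (a ord_max - a i)^-1 *: g_lead C i)
              *m simple_solution C l i) mu mu].
Proof.
move=> r1 mi; have Mi : Mpole C i = 1%N by rewrite /Mpole mi.
have iN : i != ord_max by apply: contraTneq mN => <-; rewrite mi.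
have hi : hbound C i = 1%N by rewrite /hbound (negPf iN).
pose t (j : 'I_N.+1) : nat := (j == i).
have [|d hd] := @quotient_polar t.
  move=> j; rewrite /t /hfun_pole r1 /=; case: eqP => [->|_].
    by rewrite Mi mi.
  case: eqP => [->|_]; first by rewrite /Mpole mN; lia.
  by rewrite !addn0 Mpole_le.
have ti : t i = 1%N by rewrite /t eqxx.
set g1 := g_lead C i; set Z := simple_solution C l i; set beta := (_ - _)^-1.
pose y := col mu Z; pose v1 := col mu (invmx g1 *m eta_lead C l i).
have g1y : g1 *m y = v1 + y.
  rewrite /y /v1 !colE -(simple_solutionP vert mi) -/g1 -/Z mulmxBl mul1mx mulmxBl.
  by rewrite mulmxA subrK.
have v1E p : d p i 1%N = v1 p 0.
  have h1 : has_value (a i) (s i ^+ r * hfun C x) 1.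
    rewrite /hfun -/r -/i r1 expr1 /= mulrBr (mulfV (tma_neq0 a i)).
    rewrite -[X in has_value _ _ X]subr0; apply: has_valueB; first exact: has_value1.
    rewrite -(mul0r ((a i - a ord_max) ^- 1)); apply: has_valueM.
      exact: has_value_tma0.
    by have := has_value_tmaV a_inj 1 (i := i) (l := ord_max); rewrite expr1; apply; rewrite eq_sym.
  have h2 : (hbound C i < Mpole C i + r)%N by rewrite hi Mi r1.
  have h3 : (mult C i + 1 = Mpole C i + r)%N by rewrite mi Mi r1.
  have := quotient_lead h1 h2 h3 p 0; rewrite mxE -/g1 -/v1; have [d0 ->] := hd p; rewrite -{1}ti.
  rewrite -[in d p i _]ti => hX.
  by apply: (has_value_uniq _ hX); apply: has_value_lead_polar; rewrite ti.
(* The constant beta = 1/(a_N - a_i) makes u vanish at a_N, so that gamma u has a pole of order at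
   most m_N - 1 there, as H requires. *)
pose phi := (s i)^-1 - cst K beta.
pose yF := map_mx (cst K) y; pose u := phi *: yF.
have du p : ratderiv (u p 0) = - (s i ^- 2 * cst K (y p 0)).
  rewrite mxE [yF p 0]mxE mulrC ratderivZ /phi (derB (@ratderivD K)) ratderiv_cst subr0.
  have := ratderiv_tmaXV a i 1; rewrite !expr1 => ->.
  by rewrite mulrN mul1r mulrC.
have dv p : ratderiv (v p 0) = - (s i ^- 2 * cst K (v1 p 0)).
  have [d0 ->] := hd p; rewrite ratderivD ratderiv_cst add0r (polar_split _ _ _ i) ti.
  rewrite big_nat1 expr1 v1E /polar_reg big1 ?addr0; last first.
    by move=> j /negPf ji; rewrite big1_seq // => m; rewrite mem_index_iota /t ji; lia.
  rewrite mulrC ratderivZ; have := ratderiv_tmaXV a i 1; rewrite !expr1 => ->.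
  by rewrite mulrN mul1r mulrC.
pose tv := map_mx (@ratderiv K) v + nablaK C u.
have tvE p : tv p 0 = - (s i ^- 2 * cst K (v1 p 0)) - s i ^- 2 * cst K (y p 0)
    + phi * (gam *m yF) p 0.
  have e : tv p 0 = ratderiv (v p 0) + (ratderiv (u p 0) + (gam *m u) p 0).
    by rewrite /tv /nablaK !mxE.
  by rewrite e dv du addrA; congr (_ + _); rewrite /u -scalemxAr mxE.
have ordphi : in_ord a 0 phi.
  apply: in_ordB; last exact: in_ord_cst.
  exact: in_ordW (in_ord_tmaV _ _).
have ordyF p : in_ord a 0 (yF p 0) by rewrite mxE; apply: in_ord_cst.
have ordGy p : in_ord a 2 ((gam *m yF) p 0).
  rewrite mxE; apply: in_ord_sum => p' _.
  by rewrite mulrC; apply: (@in_ordM _ _ _ 0 2); [apply: ordyF | apply: in_ord_gamma].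
have ord_tv p : in_ord a 2 (tv p 0).
  rewrite tvE; apply: in_ordD; last by apply: (@in_ordM _ _ _ 0 2); [apply: ordphi | apply: ordGy].
  apply: in_ordB; first apply: in_ordN; rewrite mulrC; apply: in_ordZ;
    exact: in_ord_tmaXV.
have value_tv p : has_value (a i) (s i * tv p 0)
    (((gam_reg_value C i - beta *: g1) *m y) p 0).
  have GyE : (gam *m yF) p 0 =
      (s i)^-1 * (cst K (v1 p 0) + cst K (y p 0)) + (gam_reg C i *m yF) p 0.
    rewrite (gamma_split mi) mulmxDl mxE -scalemxAl [X in X + _]mxE -/g1.
    by rewrite /yF -map_mxM g1y mxE mxE rmorphD.
  rewrite tvE GyE simple_pole_expansion ?(tma_neq0 a i) //.
  rewrite -rmorphD -rmorphN -rmorphM.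
  have -> : ((gam_reg_value C i - beta *: g1) *m y) p 0 =
     - beta * (v1 p 0 + y p 0) + (1 - 0 * beta) * (gam_reg_value C i *m y) p 0.
    rewrite mulmxBl -scalemxAl g1y mul0r subr0 mul1r !mxE addrC; congr (_ + _).
    by rewrite mulNr.
  apply: has_valueD; first exact: has_value_cst.
  apply: has_valueM.
    apply: has_valueB; first exact: has_value1.
    apply: has_valueM; [exact: has_value_tma0 | exact: has_value_cst].
  exact: (mx_valueM (mx_value_gam_reg C i) (mx_value_cst (a i) y)).
have reg_tv p j : regular (a j) (s j ^+ hbound C j * tv p 0).
  have [->|ji] := eqVneq j i.
    by rewrite hi expr1; apply: has_value_regular (value_tv p).
  have regi m : regular (a j) (s i ^- m).
    by apply: regular_tmaV; rewrite eq_sym.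
  rewrite tvE mulrDr; apply: regularD.
    apply: regularM; first exact/regularX/regular_tma.
    apply: regularD; apply: regularN; apply: regularM => //; exact: regular_cst.
  have regG : regular (a j) (s j ^+ mult C j * (gam *m yF) p 0).
    have := mx_valueM (mx_value_gamma C j) (mx_value_cst (a j) y).
    rewrite -scalemxAl => h; have := h p 0; rewrite mxE; exact: has_value_regular.
  have [jN|jN] := eqVneq j ord_max; last first.
    rewrite /hbound (negPf jN) mulrCA; apply: regularM => //.
    rewrite /phi; apply: regularD; last by apply: regularN; apply: regular_cst.
    by have := regi 1%N; rewrite expr1.
  have -> : phi = - cst K beta * (s j * (s i)^-1).
    have -> : s j = s i - cst K (a ord_max - a i).
      rewrite jN /tma cstE -tofracB; congr tofrac; rewrite polyCB; ring.
    apply: (inv_sub_const (tma_neq0 a i)); rewrite -rmorphM mulVf ?rmorph1 //.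
    by apply: pt_neq => //; rewrite -jN eq_sym.
  have -> : s j ^+ hbound C j * (- cst K beta * (s j * (s i)^-1) * (gam *m yF) p 0)
      = - cst K beta * (s i)^-1 * (s j ^+ mult C j * (gam *m yF) p 0).
    have -> : mult C j = (hbound C j).+1.
      by rewrite /hbound jN eqxx prednK // ltnW.
    by rewrite exprS; ring.
  apply: (regularM _ regG); apply: regularM; last by have := regi 1%N; rewrite expr1.
  by rewrite -rmorphN; apply: regular_cst.
have [f [ef hf]] := hspace_vector mN ord_tv reg_tv.
(* It is dv/dt + nabla u that lies in H, hence the sign of the witness. *)
exists (\matrix_(p, q') f p (hkey C q').1 (hkey C q').2), (- u); split.
- have [E0 EP] := in_E_subspace.
  have hu : in_E C u.
    apply/in_EP => p; rewrite mxE.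
    by apply: (@in_ordM _ _ _ 0 0); [apply: ordphi | apply: ordyF].
  by have := EP (-1) u 0 hu E0; rewrite rmorphN rmorph1 scaleN1r addr0.
- rewrite -ef /tv; have := nablaKP (-1) u 0.
  by rewrite nablaK0 rmorphN rmorph1 !scaleN1r !addr0 => ->; rewrite addrK.
have [f0 e0] := hf mu; have h1 := value_tv mu; rewrite e0 in h1.
have := @has_value_lead_polar i (hbound C) f0 (f mu); rewrite hi expr1 => /(_ isT) h2.
rewrite mxE -/x -/i -/r r1 (has_value_uniq h2 h1).
by rewrite /y colE mulmxA -colE mxE.
Qed.

End SimplePoint.

End Diagonal.

End Projections.

(** * The trace *)

(** Stated doubled to avoid division; with h = [hbound C i] it adds up the weights r - 1 of the
    irregular basis elements at a_i. *)
Lemma sum_pred_interval h : (0 < h)%N ->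
  ((\sum_(2 <= r < h.+1) r.-1) * 2 = h * h.-1)%N.
Proof.
case: h => // h _; elim: h => [|h IH]; first by rewrite big_geq.
by rewrite big_nat_recr //= mulnDl IH /=; nia.
Qed.

Section Trace.
Variables (K : fieldType) (Om : lmodType K) (n N : nat).
Variables (C : pa_connection Om n N) (l : Om -> K) (D : K -> K).
Hypothesis fl : functional l.
Hypothesis DD : forall x y, D (x + y) = D x + D y.
Hypothesis DM : forall x y, D (x * y) = x * D y + y * D x.
Hypothesis mN : (2 <= mult C ord_max)%N.
Hypothesis vert : map_mx (@ratderiv K) (eta_scalar C l) - g_der C D
  + (gammaK C *m (eta_scalar C l - g_move C D)
     - (eta_scalar C l - g_move C D) *m gammaK C) = 0.
Variables (pi_gamma pi_nabla : 'cV[ratF K]_n -> hspace C).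
Hypothesis iso_gamma : iso_quotient C (gamma_image C).
Hypothesis iso_nabla : iso_quotient C (nabla_image C).
Hypothesis proj_gamma : is_projection (gamma_image C) pi_gamma.
Hypothesis proj_nabla : is_projection (nabla_image C) pi_nabla.

Let T i := invmx (g_lead C i) *m eta_lead C l i.
Let S i := (gam_reg_value C i - (pt C ord_max - pt C i)^-1 *: g_lead C i)
           *m simple_solution C l i.

(** A matrix per basis function, so that the sum over the basis of V becomes a trace. *)
Definition diagonal_value (x : 'I_N.+1 * nat) : 'M[K]_n :=
  if x.2 == 1%N then (if mult C x.1 == 1%N then S x.1 else 0)
  else - (x.2.-1)%:R *: T x.1.

Lemma diagonal_entry mu (q : 'I_(size (hbasis C))) :
  l ((eta_op pi_gamma (delta_mx mu q) - eta_op pi_nabla (delta_mx mu q)) mu q)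
  = diagonal_value (hkey C q) mu mu.
Proof.
rewrite mxE [X in _ + X]mxE (functionalD fl) (functionalN fl).
rewrite (eta_op_scalar fl mN _ _ _ (gamma_subspace C) iso_gamma proj_gamma).
rewrite (eta_op_scalar fl mN _ _ _ (nabla_subspace C) iso_nabla proj_nabla).
set w := eta_scalar C l *m _.
have hw : in_Eomega C w.
  by apply: in_EomegaP; apply: in_ord_mulmx; [exact: in_ord_eta | exact: in_ord_sigma].
have [v hv ev] := proj_gamma hw.
have diff u b : in_E C u -> map_mx (@ratderiv K) v = sigma b + nablaK C u ->
    pi_gamma w mu q - pi_nabla w mu q = b mu q.
  move=> hu eu.
  by rewrite -(projection_difference iso_nabla proj_nabla hw hv ev hu eu) !mxE.
have [E0 _] := in_E_subspace C.
have diff0 b : map_mx (@ratderiv K) v = sigma b ->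
    pi_gamma w mu q - pi_nabla w mu q = b mu q.
  by move=> eb; apply: (diff 0 b E0); rewrite nablaK0 addr0.
rewrite /diagonal_value.
have [[r1 iN]|/andP[r2 _]] := hkeysP mN (hkey_mem q); last first.
  have [b eb e] := diagonal_irregular mN hv ev r2.
  by rewrite (diff0 b eb) e (gtn_eqF r2) [RHS]mxE.
rewrite r1 eqxx; case: (eqVneq (mult C (hkey C q).1) 1%N) => [m1|m1].
  have [b [u [hu eu e]]] := diagonal_simple mN hv ev vert r1 m1.
  by rewrite (diff u b hu eu) e.
have m2 : (2 <= mult C (hkey C q).1)%N.
  by rewrite ltn_neqAle eq_sym m1 mult_gt0.
have e0 : map_mx (@ratderiv K) v = sigma (0 : hspace C).
  by rewrite (diagonal_log mN hv ev r1 m2) sigma0.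
by rewrite (diff0 0 e0) [LHS]mxE [RHS]mxE.

Qed.

Let lam i := (\det (g_lead C i))^-1 * D (\det (g_lead C i)).

Lemma trace_formula :
  l (htrace (fun h => eta_op pi_gamma h - eta_op pi_nabla h)) * 2 =
  \sum_(i | (2 <= mult C i)%N) (mult C i)%:R * lam i
  + 2 * (\sum_(i | mult C i == 1%N) lam i - lam ord_max).
Proof.
have lamE i : lam i = \tr (invmx (g_lead C i) *m map_mx D (g_lead C i)).
  by rewrite /lam (der_det DD DM (g_lead_unit C i)).
have irr i : (2 <= mult C i)%N -> lam i = - ((mult C i).-1%:R * \tr (T i)).
  by move=> mi; rewrite lamE (irregular_trace vert mi).
have sim i : mult C i = 1%N -> \tr (S i) = lam i.
  (* The contribution of the normalisation at a_N is a multiple of Tr(g1 Z) = 0, with Z the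
     [simple_solution]. *)
  move=> mi; rewrite lamE (simple_trace vert mi) /S mulmxBl linearB /= -scalemxAl.
  by rewrite linearZ /= (simple_solution_trace vert mi) mulr0 subr0.
have -> : l (htrace (fun h => eta_op pi_gamma h - eta_op pi_nabla h)) =
    \sum_(x <- hkeys C) \tr (diagonal_value x).
  rewrite /htrace (functional_sum fl) -sum_hkey.
  rewrite (eq_bigr (fun mu : 'I_n =>
    \sum_(q < size (hbasis C)) diagonal_value (hkey C q) mu mu)); last first.
    move=> mu _; rewrite (functional_sum fl); apply: eq_bigr => q _.
    exact: diagonal_entry.
  by rewrite exchange_big.
rewrite sum_hkeys /diagonal_value /=.
have sim_sum : \sum_(i | i != ord_max) \tr (if mult C i == 1%N then S i else 0) =
    \sum_(i | mult C i == 1%N) lam i.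
  rewrite big_mkcond [RHS]big_mkcond; apply: eq_bigr => i _.
  have [->|iN] := eqVneq i ord_max; first by rewrite (gtn_eqF mN).
  by case: eqP => [mi|_]; rewrite ?sim // linear0.
rewrite sim_sum.
have irr_sum i : (\sum_(2 <= r < (hbound C i).+1)
     \tr (if r == 1%N then (if mult C i == 1%N then S i else 0) else - r.-1%:R *: T i)) * 2
   = (if (2 <= mult C i)%N then (mult C i)%:R * lam i else 0)
     - (if i == ord_max then 2 * lam i else 0).
  have -> : \sum_(2 <= r < (hbound C i).+1)
     \tr (if r == 1%N then (if mult C i == 1%N then S i else 0) else - r.-1%:R *: T i)
     = - ((\sum_(2 <= r < (hbound C i).+1) r.-1)%:R * \tr (T i)).
    rewrite natr_sum mulr_suml -sumrN; apply: eq_big_nat => r /andP[r2 _].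
    by rewrite (gtn_eqF r2) linearZ /= mulNr.
  have tri := sum_pred_interval (hbound_gt0 mN i).
  have -> : - ((\sum_(2 <= r < (hbound C i).+1) r.-1)%:R * \tr (T i)) * 2
      = - ((hbound C i * (hbound C i).-1)%:R * \tr (T i)).
    by rewrite -tri natrM; ring.
  have [iN|iN] := eqVneq i ord_max.
    rewrite iN mN (irr _ mN) /hbound eqxx natrM.
    (* At the last point H stops at order m_N - 1, so the doubled sum has factor m_N - 2 instead of
       m_N; the deficit is the term - 2 [lam ord_max]. *)
    have -> : (mult C ord_max)%:R = (mult C ord_max).-2%:R + 2 :> K.
      by rewrite -natrD; congr (_%:R); lia.
    by rewrite [_.-1.-1]/=; ring.
  rewrite subr0 /hbound (negPf iN); case: ltnP => mi; last first.
    have -> : mult C i = 1%N by apply/eqP; rewrite eqn_leq mult_gt0 mi.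
    by rewrite muln0 mul0r oppr0.
  by rewrite (irr _ mi) natrM; ring.
rewrite mulrDl mulr_suml (eq_bigr _ (fun i _ => irr_sum i)) sumrB -big_mkcond /=.
have -> : \sum_i (if i == ord_max then 2 * lam i else 0) = 2 * lam ord_max.
  by rewrite -big_mkcond big_pred1_eq.
by ring.
Qed.

End Trace.

(** * The trace congruence modulo logarithmic differentials *)

Theorem theorem3p6 (k K : fieldType) (emb : {rmorphism k -> K})
    (Om : lmodType K) (d : K -> Om)
    (OmF Om2F : lmodType (ratF K)) (dF : ratF K -> OmF)
    (wedge : OmF -> OmF -> Om2F) (d1 : OmF -> Om2F) (j : Om -> OmF)
    (n N : nat) (C : pa_connection Om n N)
    (pi_gamma pi_nabla : 'cV[ratF K]_n -> hspace C) :
  [pchar k] =i pred0 ->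
  function_field emb ->
  kaehler emb d ->
  kaehler (base_to_rat emb) dF ->
  exterior_square wedge ->
  exterior_derivative dF wedge d1 ->
  pullback d dF j ->
  vertical C dF wedge d1 j ->
  (2 <= mult C ord_max)%N ->
  iso_quotient C (gamma_image C) ->
  iso_quotient C (nabla_image C) ->
  is_projection (gamma_image C) pi_gamma ->
  is_projection (nabla_image C) pi_nabla ->
  exists2 c : K, c != 0 &
    htrace (fun h => eta_op pi_gamma h - eta_op pi_nabla h)
    = 2^-1 *: (\sum_(i | (2 <= mult C i)%N)
                      (mult C i)%:R *: dlog d (\det (g C i (mult C i))))
      + dlog d c.
Proof.
move=> char0 ff kd kdF ext2 extd pb vert mN isoG isoN pG pN.
have two0 : 2%:R != 0 :> K.
  have := char0 2%N; rewrite !inE /= => /negbT two0.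
  by rewrite -(rmorph_nat emb) fmorph_eq0.
have det0 i : \det (g_lead C i) != 0.
  by rewrite -unitfE -unitmxE g_lead_unit.
have P0 : \prod_(i | mult C i == 1%N) \det (g_lead C i) != 0.
  by apply/prodf_neq0 => i _; apply: det0.
(* Its logarithmic derivative is the bracket multiplied by 2 in [trace_formula]. *)
exists (\prod_(i | mult C i == 1%N) \det (g_lead C i) / \det (g_lead C ord_max)).
  by rewrite mulf_neq0 ?invr_eq0 ?det0.
apply/eqP; rewrite -subr_eq0; apply/eqP.
apply: (kaehler_separate ff kd) => l fl.
rewrite (functionalD fl) (functionalN fl); apply/eqP; rewrite subr_eq0; apply/eqP.
have DD := functional_derD kd fl; have DM := functional_derM kd fl.
have vid := vertical_identity kd kdF ext2 extd pb vert fl.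
(* Both sides are doubled to match [trace_formula]; 2 is invertible in characteristic 0. *)
apply: (mulIf two0).
rewrite (trace_formula fl DD DM mN vid isoG isoN pG pN).
rewrite (functionalD fl) (functionalZ fl) (functional_sum fl) [RHS]mulrDl.
rewrite [X in _ = X + _]mulrAC (mulVf two0) mul1r.
congr (_ + _).
  by apply: eq_bigr => i _; rewrite (functionalZ fl) /dlog (functionalZ fl).
rewrite mulrC /dlog (functionalZ fl); congr (_ * _).
rewrite (der_dlogM DM) ?invr_eq0 ?det0 // (der_dlogV DM (det0 _)).
by rewrite (der_dlog_prod DM) // => i _.
Qed.
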